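(* (a) The modified trace conjecture of Baum-Connes holds for all groups if and only if it holds for all binate groups. (b) The Farkas conjecture holds for all groups if and only if it holds for all binate groups.
   Context: Groups are discrete. Write $[u,v]=uvu^{-1}v^{-1}$. A nontrivial group $G$ is called binate if for every finitely generated subgroup $H$ of $G$ there exist a homomorphism $\varphi_H:H\rightarrow G$ and an element $u_H\in G$ such that $h=[u_H,\varphi_H(h)]$ for all $h\in H$. For a discrete group $G$, let $C_r^*(G)$ be its reduced $C^*$-algebra and $\mathcal{N}(G)$ its group von Neumann algebra. Let $i:K_0(C_r^*(G))\rightarrow K_0(\mathcal{N}(G))$ be induced by the standard inclusion, and let $\mathrm{tr}_{\mathcal{N}(G)}:K_0(\mathcal{N}(G))\rightarrow\mathbb{C}$ be the map induced by the standard complex-valued von Neumann trace on $\mathcal{N}(G)$. The Kaplansky trace is $\kappa=\mathrm{tr}_{\mathcal{N}(G)}\circ i:K_0(C_r^*(G))\rightarrow\mathbb{C}$. Let $\Lambda_G\subseteq\mathbb{Q}$ be the ring of rational numbers whose denominators are products of the orders of finite subgroups of $G$ (that is, the subring of $\mathbb{Q}$ generated by all $1/|F|$, $F$ a finite subgroup of $G$). The modified trace conjecture of Baum-Connes for $G$ asserts that the image of $\kappa$ lies in $\Lambda_G$. The Farkas conjecture for $G$ asserts that $G$ has elements of all prime orders that occur as denominators of nonintegral rational numbers (in lowest terms) in the image of the composition $$K_0(\mathbb{C}G)\rightarrow K_0(C_r^*(G))\xrightarrow{\ i\ }K_0(\mathcal{N}(G))\xrightarrow{\mathrm{tr}_{\mathcal{N}(G)}}\mathbb{C},$$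 where the first map is induced by the inclusion $\mathbb{C}G\subseteq C_r^*(G)$. *)

(* Defs.v *)
From HB Require Import structures.
From mathcomp Require Import all_boot all_order all_algebra.
From mathcomp Require Import generic_quotient finmap complex lra.
From mathcomp Require Import all_classical all_reals all_analysis.

Set Implicit Arguments.
Unset Strict Implicit.
Unset Printing Implicit Defensive.
Import Order.TTheory GRing.Theory Num.Theory.
Local Open Scope ring_scope.
Local Open Scope complex_scope.
Local Open Scope classical_set_scope.

Section Groups.
Variable G : groupType.
Implicit Types (H K : {pred G}) (g u : G).

Definition finitely_generated H := exists s : seq G, {subset s <= H} /\
  forall K, group_closed K -> {subset s <= K} -> {subset H <= K}.

(* A homomorphism H -> G is represented by a function on G of which only the  *)
(* values on H matter. The commutator is the convention [u, v] = u v u^-1     *)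
(* v^-1, which differs from MathComp's [~ u, v] = u^-1 v^-1 u v.              *)
Definition binate := (exists g, g != 1%g) /\
  forall H, group_closed H -> finitely_generated H ->
  exists (phi : G -> G) (u : G),
    {in H &, {morph phi : x y / (x * y)%g}} /\
    {in H, forall h, h = (u * phi h * u^-1 * (phi h)^-1)%g}.

Definition Lambda : set rat := [set q | forall S : {pred rat}, subring_closed S ->
  (forall F : {fset G}, group_closed [in F] -> (#|` F|%:R)^-1 \in S) -> q \in S].

Definition has_order g (n : nat) := (0 < n)%N /\ (g ^+ n)%g = 1%g /\
  forall m, (0 < m < n)%N -> (g ^+ m)%g != 1%g.

End Groups.

Section GrothendieckGroup.
Local Open Scope quotient_scope.
Variable M : nmodType.

(* (a, b) stands for the formal difference [a] - [b]. *)
Definition groth_rel : rel (M * M) := fun x y =>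
  `[< exists c : M, x.1 + y.2 + c = y.1 + x.2 + c >].

Lemma groth_rel_refl : reflexive groth_rel.
Proof. by move=> x; apply/asboolP; exists 0. Qed.

Lemma groth_rel_sym : symmetric groth_rel.
Proof. by move=> x y; apply/asboolP/asboolP => -[c e]; exists c. Qed.

Lemma groth_rel_trans : transitive groth_rel.
Proof.
move=> y x z /asboolP[c e] /asboolP[d e']; apply/asboolP.
exists (y.1 + y.2 + c + d).
have -> : x.1 + z.2 + (y.1 + y.2 + c + d)
    = (x.1 + y.2 + c) + (y.1 + z.2 + d).
  by rewrite !addrA [LHS](ACl (1*4*5*3*2*6))/= .
by rewrite e e' !addrA [LHS](ACl (4*2*1*5*3*6))/=.
Qed.

Canonical groth_equiv :=
  EquivRel groth_rel groth_rel_refl groth_rel_sym groth_rel_trans.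

Definition groth := {eq_quot groth_rel}.
HB.instance Definition _ : EqQuotient _ groth_rel groth := EqQuotient.on groth.
HB.instance Definition _ := Choice.on groth.

Lemma groth_eqP (x y : M * M) :
  reflect (exists c : M, x.1 + y.2 + c = y.1 + x.2 + c)
          (\pi_groth x == \pi_groth y).
Proof. by rewrite eqmodE /=; apply: (iffP idP) => [/asboolP|?]; [|apply/asboolP]. Qed.

Lemma groth_reprP (x : M * M) : exists c : M,
  (repr (\pi_groth x)).1 + x.2 + c = x.1 + (repr (\pi_groth x)).2 + c.
Proof. by apply/groth_eqP; rewrite reprK. Qed.

Definition groth_add (u v : groth) : groth :=
  \pi_groth ((repr u).1 + (repr v).1, (repr u).2 + (repr v).2).
Definition groth_opp (u : groth) : groth := \pi_groth ((repr u).2, (repr u).1).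

Lemma groth_addE (x y : M * M) :
  groth_add (\pi_groth x) (\pi_groth y) = \pi_groth (x.1 + y.1, x.2 + y.2).
Proof.
have [c ec] := groth_reprP x; have [d ed] := groth_reprP y.
apply/eqP/groth_eqP; exists (c + d) => /=.
by rewrite [LHS](AC (2*2*2) ((1*3*5)*(2*4*6)))/= ec ed
  [LHS](AC (3*3) ((1*4)*(2*5)*(3*6))).
Qed.

Lemma groth_oppE (x : M * M) : groth_opp (\pi_groth x) = \pi_groth (x.2, x.1).
Proof.
have [c ec] := groth_reprP x; apply/eqP/groth_eqP; exists c => /=.
by rewrite [(repr _).2 + _]addrC -ec [x.2 + _]addrC.
Qed.

Lemma groth_addA : associative groth_add.
Proof.
elim/quotW=> x; elim/quotW=> y; elim/quotW=> z; rewrite (groth_addE y z) (groth_addE x).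
by rewrite (groth_addE x y) (groth_addE _ z)/= !addrA.
Qed.

Lemma groth_addC : commutative groth_add.
Proof.
by elim/quotW=> x; elim/quotW=> y; rewrite !groth_addE addrC [x.2 + _]addrC.
Qed.

Lemma groth_add0 : left_id (\pi_groth (0, 0)) groth_add.
Proof. by elim/quotW=> -[a b]; rewrite groth_addE /= !add0r. Qed.

Lemma groth_addN : left_inverse (\pi_groth (0, 0)) groth_opp groth_add.
Proof.
elim/quotW=> x; rewrite groth_oppE groth_addE; apply/eqP/groth_eqP.
by exists 0; rewrite /= !addr0 add0r addrC.
Qed.

HB.instance Definition _ := GRing.isZmodule.Build groth
  groth_addA groth_addC groth_add0 groth_addN.

Definition groth_in (a : M) : groth := \pi_groth (a, 0).

Lemma groth_in_is_nmod_morphism : nmod_morphism groth_in.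
Proof.
split=> // a b; rewrite /groth_in.
by rewrite -[RHS]/(groth_add _ _) groth_addE /= addr0.
Qed.
HB.instance Definition _ :=
  GRing.isNmodMorphism.Build M groth groth_in groth_in_is_nmod_morphism.

Lemma groth_piE (x : M * M) : \pi_groth x = groth_in x.1 - groth_in x.2.
Proof.
rewrite -[RHS]/(groth_add _ (groth_opp _)) groth_oppE groth_addE /=.
by rewrite addr0 add0r; case: x.
Qed.

Definition groth_lift (Z : zmodType) (f : M -> Z) (u : groth) : Z :=
  f (repr u).1 - f (repr u).2.

Section Lift.
Variables (Z : zmodType) (f : {additive M -> Z}).

Lemma groth_lift_pi (x : M * M) : groth_lift f (\pi_groth x) = f x.1 - f x.2.
Proof.
have [c /(congr1 f)] := groth_reprP x; rewrite !raddfD => /addIr e.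
by apply/eqP; rewrite subr_eq addrAC -subr_eq opprK e.
Qed.

Lemma groth_lift_in (a : M) : groth_lift f (groth_in a) = f a.
Proof. by rewrite groth_lift_pi raddf0 subr0. Qed.

Lemma groth_lift_is_zmod_morphism : zmod_morphism (groth_lift f).
Proof.
elim/quotW=> x; elim/quotW=> y; rewrite [_ - _](_ : _ =
   groth_add (\pi_groth x) (groth_opp (\pi_groth y))) // groth_oppE groth_addE.
rewrite (groth_lift_pi (_, _)) (groth_lift_pi x) (groth_lift_pi y) /=.
by rewrite !(raddfD f) opprD opprB addrACA.
Qed.
HB.instance Definition _ :=
  GRing.isZmodMorphism.Build groth Z (groth_lift f) groth_lift_is_zmod_morphism.
End Lift.

End GrothendieckGroup.

Record idempotent_mx (A : pzRingType) := IdempotentMx {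
  idem_size : nat;
  idem_mx :> 'M[A]_idem_size;
  idem_mxP : idem_mx *m idem_mx = idem_mx
}.

HB.instance Definition _ (A : pzRingType) := gen_eqMixin (idempotent_mx A).
HB.instance Definition _ (A : pzRingType) := gen_choiceMixin (idempotent_mx A).

Section ProjClass.
Local Open Scope quotient_scope.
Variable A : pzRingType.
Implicit Types p q r : idempotent_mx A.

(* p = u v and q = v u: the finitely generated projective modules that are    *)
(* the images of p and q are isomorphic (u and v may be taken in p M q and    *)
(* q M p). Hence proj_class A is the monoid of isomorphism classes of         *)
(* finitely generated projective A-modules.                                   *)
Definition idem_rel : rel (idempotent_mx A) := fun p q =>
  `[< exists u v, u *m v = idem_mx p /\ v *m u = idem_mx q >].

Lemma idem_rel_refl : reflexive idem_rel.
Proof. by move=> p; apply/asboolP; exists p, p; rewrite idem_mxP. Qed.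

Lemma idem_rel_sym : symmetric idem_rel.
Proof. by move=> p q; apply/asboolP/asboolP => -[u [v [? ?]]]; exists v, u. Qed.

Lemma idem_rel_trans : transitive idem_rel.
Proof.
move=> q p r /asboolP[u [v [uv vu]]] /asboolP[w [z [wz zw]]]; apply/asboolP.
exists (u *m w), (z *m v); split.
  by rewrite mulmxA -(mulmxA u) wz -vu mulmxA uv -mulmxA uv idem_mxP.
by rewrite mulmxA -(mulmxA z) vu -wz mulmxA zw -mulmxA zw idem_mxP.
Qed.

Canonical idem_equiv :=
  EquivRel idem_rel idem_rel_refl idem_rel_sym idem_rel_trans.

Definition proj_class := {eq_quot idem_rel}.
HB.instance Definition _ : EqQuotient _ idem_rel proj_class :=
  EqQuotient.on proj_class.
HB.instance Definition _ := Choice.on proj_class.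

Lemma proj_class_eqP p q :
  reflect (exists u v, u *m v = idem_mx p /\ v *m u = idem_mx q)
          (\pi_proj_class p == \pi_proj_class q).
Proof. by rewrite eqmodE /=; apply: (iffP idP) => [/asboolP|?]; [|apply/asboolP]. Qed.

Lemma idem_dsum_subproof p q :
  block_mx (idem_mx p) 0 0 (idem_mx q) *m block_mx (idem_mx p) 0 0 (idem_mx q)
  = block_mx (idem_mx p) 0 0 (idem_mx q).
Proof. by rewrite mulmx_block !(mulmx0, mul0mx, addr0, add0r) !idem_mxP. Qed.

Definition idem_dsum p q := IdempotentMx (idem_dsum_subproof p q).

Definition idem0 : idempotent_mx A :=
  @IdempotentMx A 0 0 (mul0mx 0 (0 : 'M[A]_0)).

Definition proj_add (x y : proj_class) : proj_class :=
  \pi_proj_class (idem_dsum (repr x) (repr y)).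

Lemma proj_addE p q : proj_add (\pi p) (\pi q) = \pi_proj_class (idem_dsum p q).
Proof.
have /proj_class_eqP[u [v [uv vu]]] :
  \pi_proj_class (repr (\pi_proj_class p)) == \pi_proj_class p by rewrite reprK.
have /proj_class_eqP[w [z [wz zw]]] :
  \pi_proj_class (repr (\pi_proj_class q)) == \pi_proj_class q by rewrite reprK.
apply/eqP/proj_class_eqP; exists (block_mx u 0 0 w), (block_mx v 0 0 z) => /=.
by rewrite !mulmx_block !(mulmx0, mul0mx, addr0, add0r) uv vu wz zw.
Qed.

Lemma proj_addC : commutative proj_add.
Proof.
elim/quotW=> p; elim/quotW=> q; rewrite !proj_addE.
apply/eqP/proj_class_eqP.
exists (block_mx 0 (idem_mx p) (idem_mx q) 0).
exists (block_mx 0 (idem_mx q) (idem_mx p) 0) => /=.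
by rewrite !mulmx_block !(mulmx0, mul0mx, addr0, add0r) !idem_mxP.
Qed.

Lemma idem_eq_cast p q (e : idem_size q = idem_size p) :
  idem_mx p = castmx (e, e) (idem_mx q) -> \pi_proj_class p = \pi_proj_class q.
Proof.
case: p q e => m p pP [n q qP] /= e; case: m / e p pP => p pP.
rewrite castmx_id => epq; apply/eqP/proj_class_eqP => /=.
by exists p, p; rewrite pP; split=> //=.
Qed.

Lemma proj_addA : associative proj_add.
Proof.
elim/quotW=> p; elim/quotW=> q; elim/quotW=> r.
rewrite (proj_addE q r) (proj_addE p q).
rewrite (proj_addE p (idem_dsum q r)) (proj_addE (idem_dsum p q) r).
have e : idem_size (idem_dsum (idem_dsum p q) r)
    = idem_size (idem_dsum p (idem_dsum q r)) by rewrite /= addnA.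
apply: (idem_eq_cast (e := e)) => /=; rewrite (eq_irrelevance e (esym (addnA _ _ _))).
have := @block_mxA _ _ _ _ _ _ _ (idem_mx p) 0 0 0 (idem_mx q) 0 0 0 (idem_mx r).
by rewrite /= !row_mx0 !col_mx0 => ->.
Qed.

Lemma proj_add0 : left_id (\pi_proj_class idem0) proj_add.
Proof.
elim/quotW=> p; rewrite proj_addE; apply/eqP/proj_class_eqP => /=.
exists (col_mx 0 (idem_mx p)), (row_mx 0 (idem_mx p)); split.
  by rewrite mul_col_row !(mul0mx, mulmx0) idem_mxP.
by rewrite mul_row_col mul0mx add0r idem_mxP.
Qed.

HB.instance Definition _ :=
  GRing.isNmodule.Build proj_class proj_addA proj_addC proj_add0.

Definition K0 := groth proj_class.

End ProjClass.

Section K0map.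
Local Open Scope quotient_scope.
Variables (A B : pzRingType) (f : {rmorphism A -> B}).

Lemma map_idem_subproof (p : idempotent_mx A) :
  map_mx f (idem_mx p) *m map_mx f (idem_mx p) = map_mx f (idem_mx p).
Proof. by rewrite -map_mxM idem_mxP. Qed.

Definition map_idem (p : idempotent_mx A) := IdempotentMx (map_idem_subproof p).

Definition proj_map (x : proj_class A) : proj_class B := \pi_(proj_class B) (map_idem (repr x)).

Lemma proj_map_pi p : proj_map (\pi p) = \pi_(proj_class B) (map_idem p).
Proof.
have /proj_class_eqP[u [v [uv vu]]] :
  \pi_(proj_class A) (repr (\pi_(proj_class A) p)) == \pi p by rewrite reprK.
apply/eqP/proj_class_eqP; exists (map_mx f u), (map_mx f v).
by rewrite -!map_mxM uv vu.
Qed.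

Lemma proj_map_is_nmod_morphism : nmod_morphism proj_map.
Proof.
split.
  rewrite [X in proj_map X](_ : _ = \pi_(proj_class A) (idem0 A)) // proj_map_pi.
  apply/eqP/proj_class_eqP; exists 0, 0; by split; apply/matrixP => -[].
elim/quotW=> p; elim/quotW=> q.
rewrite -[_ + _]/(proj_add _ _) proj_addE !proj_map_pi.
rewrite -[RHS]/(proj_add _ _) proj_addE.
apply/eqP/proj_class_eqP; pose m := idem_mx (map_idem (idem_dsum p q)).
by exists m, m; split; rewrite [m *m m]idem_mxP //= map_block_mx !map_mx0.
Qed.
HB.instance Definition _ := GRing.isNmodMorphism.Build
  (proj_class A) (proj_class B) proj_map proj_map_is_nmod_morphism.

Definition K0map : K0 A -> K0 B :=
  groth_lift (@groth_in (proj_class B) \o proj_map).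
HB.instance Definition _ := GRing.Additive.on K0map.
End K0map.

Section K0trace.
Local Open Scope quotient_scope.
Variables (A : pzRingType) (Z : zmodType) (tau : {additive A -> Z}).
Hypothesis tauC : forall a b : A, tau (a * b) = tau (b * a).
Implicit Types p q : idempotent_mx A.

Definition proj_trace (x : proj_class A) : Z := tau (mxtrace (idem_mx (repr x))).

Lemma tau_mxtraceC m n (u : 'M[A]_(m, n)) (v : 'M[A]_(n, m)) :
  tau (mxtrace (u *m v)) = tau (mxtrace (v *m u)).
Proof.
rewrite /mxtrace !raddf_sum /=.
under eq_bigr do rewrite mxE raddf_sum.
rewrite exchange_big; apply: eq_bigr => i _ /=.
by rewrite mxE raddf_sum; apply: eq_bigr => j _; rewrite tauC.
Qed.

Lemma proj_trace_pi p : proj_trace (\pi p) = tau (mxtrace (idem_mx p)).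
Proof.
have /proj_class_eqP[u [v [uv vu]]] :
  \pi_(proj_class A) (repr (\pi_(proj_class A) p)) == \pi p by rewrite reprK.
by rewrite /proj_trace -uv -vu tau_mxtraceC.
Qed.

Lemma proj_trace_is_nmod_morphism : nmod_morphism proj_trace.
Proof.
split.
  rewrite [X in proj_trace X](_ : _ = \pi_(proj_class A) (idem0 A)) // proj_trace_pi.
  by rewrite /mxtrace big_ord0 raddf0.
elim/quotW=> p; elim/quotW=> q.
rewrite -[_ + _]/(proj_add _ _) proj_addE !proj_trace_pi /=.
by rewrite mxtrace_block raddfD.
Qed.
End K0trace.

(* The homomorphism [p] |-> tau (sum of the diagonal entries of p); it is     *)
(* well defined as soon as tau (a b) = tau (b a).                             *)
Definition K0trace (A : pzRingType) (Z : zmodType) (tau : {additive A -> Z}) :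
  K0 A -> Z := groth_lift (proj_trace tau).

Lemma K0trace_is_zmod_morphism (A : pzRingType) (Z : zmodType) (tau : {additive A -> Z}) :
  (forall a b : A, tau (a * b) = tau (b * a)) -> zmod_morphism (K0trace tau).
Proof.
move=> /proj_trace_is_nmod_morphism h.
pose f := GRing.isNmodMorphism.Build _ _ (proj_trace tau) h.
pose F : {additive proj_class A -> Z} := HB.pack (proj_trace tau) f.
exact: (groth_lift_is_zmod_morphism F).
Qed.

Section SquareModulus.
Variable R : realType.
Implicit Types z w : R[i].

Definition sqmod z : R := Normc.normc z ^+ 2.

Lemma sqmodE z : sqmod z = complex.Re z ^+ 2 + complex.Im z ^+ 2.
Proof. by case: z => a b; rewrite /sqmod /= sqr_sqrtr // addr_ge0 ?sqr_ge0. Qed.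

Lemma sqmod_ge0 z : 0 <= sqmod z.
Proof. exact: sqr_ge0. Qed.

Lemma sqmodM z w : sqmod (z * w) = sqmod z * sqmod w.
Proof. by rewrite /sqmod Normc.normcM exprMn. Qed.

Lemma sqmod0 : sqmod 0 = 0.
Proof. by rewrite /sqmod Normc.normc0 expr0n. Qed.

Lemma sqmod1 : sqmod 1 = 1.
Proof. by rewrite /sqmod Normc.normc1 expr1n. Qed.

Lemma sqmod_eq0 z : sqmod z = 0 -> z = 0.
Proof. by move=> /eqP; rewrite expf_eq0 /= => /eqP /Normc.eq0_normc. Qed.

Lemma sqmodD z w : sqmod (z + w) <= 2 * (sqmod z + sqmod w).
Proof.
rewrite !sqmodE; case: z w => [a b] [c d] /=.
have := sqr_ge0 (a - c); have := sqr_ge0 (b - d); nra.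
Qed.

End SquareModulus.


Section SquareSummable.
Variables (R : realType) (G : choiceType).
Local Notation C := R[i].
Implicit Types (f g : G -> C) (F : {fset G}).

Definition sqsum f : \bar R := \esum_(x in [set: G]) (sqmod (f x))%:E.

Definition square_summable : {pred G -> C} := fun f => (sqsum f < +oo)%E.

Definition l2norm f : R := Num.sqrt (fine (sqsum f)).

Lemma sqsum_ge0 f : (0 <= sqsum f)%E.
Proof. by apply: esum_ge0 => x _; rewrite lee_fin sqmod_ge0. Qed.

Lemma sqsum_leP f (M : R) :
  (sqsum f <= M%:E)%E <-> forall F, \sum_(x <- F) sqmod (f x) <= M.
Proof.
split=> [h F|h].
  rewrite -lee_fin; apply: le_trans h; apply: esum_ge.
  exists [set` F]; first by split => //; exact: finite_fset.
  by rewrite fsbig_finite ?finite_fset //= set_fsetK sumEFin.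
apply: ge_ereal_sup => _ [X [finX _] <-].
by rewrite fsbig_finite //= sumEFin lee_fin.
Qed.

Lemma l2norm_ge0 f : 0 <= l2norm f.
Proof. exact: sqrtr_ge0. Qed.

Lemma l2norm_leP f (M : R) : 0 <= M ->
  (f \in square_summable /\ l2norm f <= M) <->
  forall F, \sum_(x <- F) sqmod (f x) <= M ^+ 2.
Proof.
move=> M0; rewrite -sqsum_leP; split=> [[f2]|h].
  have ff : sqsum f \is a fin_num by rewrite ge0_fin_numE ?sqsum_ge0.
  rewrite -[X in _ <= X]ger0_norm // -sqrtr_sqr ler_sqrt ?sqr_ge0 //.
  by rewrite -lee_fin fineK.
have f2 : f \in square_summable by exact: le_lt_trans h (ltry _).
have ff : sqsum f \is a fin_num by rewrite ge0_fin_numE ?sqsum_ge0.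
split=> //; rewrite -[X in _ <= X]ger0_norm // -sqrtr_sqr ler_sqrt ?sqr_ge0 //.
by rewrite -lee_fin fineK.
Qed.

Lemma l2norm_sum f F : f \in square_summable ->
  \sum_(x <- F) sqmod (f x) <= l2norm f ^+ 2.
Proof. by move=> f2; apply: ((l2norm_leP f (l2norm_ge0 f)).1 _ F). Qed.

Lemma l2norm_coord f x : f \in square_summable -> sqmod (f x) <= l2norm f ^+ 2.
Proof. by move=> /(l2norm_sum [fset x]%fset); rewrite big_seq_fset1. Qed.

Lemma l2norm0 : (0 : G -> C) \in square_summable /\ l2norm 0 <= 0.
Proof.
apply/l2norm_leP => // F; rewrite expr0n /=.
by rewrite big1 // => i _; rewrite sqmod0.
Qed.

Lemma l2normZ (a : C) f : f \in square_summable ->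
  (a *: f) \in square_summable /\ l2norm (a *: f) <= Normc.normc a * l2norm f.
Proof.
move=> f2; apply/l2norm_leP => [|F].
  by rewrite mulr_ge0 ?l2norm_ge0 //; case: a => *; exact: sqrtr_ge0.
under eq_bigr do rewrite sqmodM.
by rewrite -mulr_sumr exprMn ler_wpM2l ?sqmod_ge0 // l2norm_sum.
Qed.

Lemma l2normD f g : f \in square_summable -> g \in square_summable ->
  (f + g) \in square_summable /\ l2norm (f + g) <= 2 * (l2norm f + l2norm g).
Proof.
move=> f2 g2; have f0 := l2norm_ge0 f; have g0 := l2norm_ge0 g.
apply/l2norm_leP => [|F]; first by rewrite mulr_ge0 ?addr_ge0.
apply: (@le_trans _ _ (\sum_(x <- F) 2 * (sqmod (f x) + sqmod (g x)))).
  by apply: ler_sum => x _; exact: sqmodD.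
rewrite -mulr_sumr big_split /=.
have := l2norm_sum F f2; have := l2norm_sum F g2; nra.
Qed.

Lemma square_summable_submod : submod_closed square_summable.
Proof.
split=> [|a f g f2 g2]; first by case: l2norm0.
by case: (l2normD (l2normZ a f2).1 g2).
Qed.

Record l2 := L2 { l2fun :> G -> C; l2P : l2fun \in square_summable }.
HB.instance Definition _ := [isSub for l2fun].
HB.instance Definition _ := [Choice of l2 by <:].
HB.instance Definition _ :=
  GRing.SubChoice_isSubLmodule.Build C (G -> C) square_summable l2
    square_summable_submod.

End SquareSummable.

Section BoundedOperators.
Variables (R : realType) (G : choiceType).
Local Notation C := R[i].
Local Notation l2 := (l2 R G).
Implicit Types (f g : l2).

Lemma l2D f g : l2norm (f + g : l2) <= 2 * (l2norm f + l2norm g).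
Proof. by have [_] := l2normD (l2P f) (l2P g). Qed.

Lemma l2Z (a : C) f : l2norm (a *: f : l2) <= Normc.normc a * l2norm f.
Proof. by have [_] := l2normZ a (l2P f). Qed.

Lemma l2N f : l2norm (- f : l2) <= l2norm f.
Proof.
rewrite -scaleN1r; apply: le_trans (l2Z _ _) _.
by rewrite -[- 1]mulN1r Normc.normcM Normc.normc1 mulr1 /= oppr0 expr0n addr0
  sqrrN expr1n sqrtr1 mul1r.
Qed.

Lemma l2norm_eq0 f : l2norm f <= 0 -> f = 0.
Proof.
move=> f0; apply/val_inj/funext => x /=; apply: sqmod_eq0.
have e : l2norm f = 0 by apply/eqP; rewrite eq_le f0 l2norm_ge0.
apply/eqP; rewrite eq_le sqmod_ge0 andbT.
by have := l2norm_coord x (l2P f); rewrite e expr0n.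
Qed.

Definition bounded_operator : {pred l2 -> l2} := fun T =>
  `[< linear T /\ exists M : R, forall f, l2norm (T f) <= M * l2norm f >].

Lemma bounded_operator_submod : submod_closed bounded_operator.
Proof.
split=> [|a S T /asboolP[linS [M SM]] /asboolP[linT [N TN]]]; apply/asboolP.
  split=> [c f g|]; first by rewrite scaler0 addr0.
  by exists 0 => f; rewrite mul0r; case: (@l2norm0 R G).
split=> [c f g|].
  rewrite -[LHS]/(a *: S (c *: f + g) + T (c *: f + g)).
  rewrite -[RHS]/(c *: (a *: S f + T f) + (a *: S g + T g)).
  by rewrite linS linT !scalerDr !scalerA addrACA [a * c]mulrC.
exists (2 * (Normc.normc a * M + N)) => f.
apply: le_trans (l2D _ _) _; rewrite -mulrA ler_pM2l // mulrDl lerD //.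
apply: le_trans (l2Z _ _) _; rewrite -mulrA ler_wpM2l //.
by case: a => *; exact: sqrtr_ge0.
Qed.

Record bop := Bop { bop_fun :> l2 -> l2; bopP : bop_fun \in bounded_operator }.
HB.instance Definition _ := [isSub for bop_fun].
HB.instance Definition _ := [Choice of bop by <:].
HB.instance Definition _ :=
  GRing.SubChoice_isSubLmodule.Build C (l2 -> l2) bounded_operator bop
    bounded_operator_submod.

Implicit Types S T U : bop.

Lemma bop_linear T : linear T.
Proof. by case/asboolP: (bopP T). Qed.

HB.instance Definition _ T := GRing.isLinear.Build C l2 l2 _ T (@bop_linear T).

Lemma bop_bounded T : exists2 M : R, 0 <= M & forall f, l2norm (T f) <= M * l2norm f.
Proof.
case/asboolP: (bopP T) => _ [M TM]; exists `|M|; first exact: normr_ge0.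
move=> f; apply: le_trans (TM f) _; rewrite ler_wpM2r ?l2norm_ge0 //.
exact: ler_norm.
Qed.

Lemma bop1_subproof : id \in bounded_operator.
Proof. by apply/asboolP; split=> // ; exists 1 => f; rewrite mul1r. Qed.

Lemma bopM_subproof S T : S \o T \in bounded_operator.
Proof.
apply/asboolP; split=> [c f g|]; first by rewrite /= !linearP.
have [M M0 SM] := bop_bounded S; have [N N0 TN] := bop_bounded T.
exists (M * N) => f; apply: le_trans (SM _) _.
by rewrite -mulrA ler_wpM2l.
Qed.

Definition bop1 := Bop bop1_subproof.
Definition bopM S T := Bop (bopM_subproof S T).

Lemma bopMA : associative bopM.
Proof. by move=> S T U; apply: val_inj. Qed.
Lemma bop1M : left_id bop1 bopM.
Proof. by move=> S; apply: val_inj. Qed.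
Lemma bopM1 : right_id bop1 bopM.
Proof. by move=> S; apply: val_inj. Qed.
Lemma bopMDl : left_distributive bopM +%R.
Proof. by move=> S T U; apply: val_inj. Qed.
Lemma bopMDr : right_distributive bopM +%R.
Proof. by move=> S T U; apply/val_inj/funext => f /=; rewrite linearD. Qed.

HB.instance Definition _ :=
  GRing.Zmodule_isPzRing.Build bop bopMA bop1M bopM1 bopMDl bopMDr.

Lemma bopE : (forall S T f, (S + T) f = S f + T f) * (forall S f, (- S) f = - S f)
  * (forall (a : C) S f, (a *: S) f = a *: S f) * (forall S T f, (S * T) f = S (T f)).
Proof. by []. Qed.

Lemma bop_inj S T : (forall f, S f = T f) -> S = T.
Proof. by move=> e; apply/val_inj/funext. Qed.

Lemma bop_scaleM (a b : C) S T : (a *: S) * (b *: T) = (a * b) *: (S * T).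
Proof. by apply: bop_inj => f; rewrite !bopE linearZ /= scalerA. Qed.

Definition opnorm T : R :=
  inf [set M : R | 0 <= M /\ forall f, l2norm (T f) <= M * l2norm f].

Lemma opnorm_lbound T :
  has_inf [set M : R | 0 <= M /\ forall f, l2norm (T f) <= M * l2norm f].
Proof.
by split; [have [M ? ?] := bop_bounded T; exists M | exists 0 => M []].
Qed.

Lemma opnorm_ge0 T : 0 <= opnorm T.
Proof. by apply: lb_le_inf => [|M []//]; case: (opnorm_lbound T). Qed.

Lemma opnormP T f : l2norm (T f) <= opnorm T * l2norm f.
Proof.
have [f0|f0] := leP (l2norm f) 0.
  rewrite (l2norm_eq0 f0) linear0.
  by apply: le_trans (l2norm0 R G).2 _; rewrite mulr_ge0 ?opnorm_ge0 ?l2norm_ge0.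
rewrite -ler_pdivrMr //; apply: lb_le_inf => [|M [_ TM]].
  by case: (opnorm_lbound T).
by rewrite ler_pdivrMr.
Qed.

Lemma opnorm_le T M : 0 <= M -> (forall f, l2norm (T f) <= M * l2norm f) ->
  opnorm T <= M.
Proof. by move=> M0 TM; apply: ge_inf => //; case: (opnorm_lbound T). Qed.

Lemma opnorm_eq0 T : opnorm T <= 0 -> T = 0.
Proof.
move=> T0; apply: bop_inj => f; apply: l2norm_eq0.
by apply: le_trans (opnormP T f) _; rewrite mulr_le0_ge0 ?l2norm_ge0.
Qed.

Lemma opnormD S T : opnorm (S + T) <= 2 * (opnorm S + opnorm T).
Proof.
apply: opnorm_le => [|f]; first by rewrite mulr_ge0 ?addr_ge0 ?opnorm_ge0.
apply: le_trans (l2D _ _) _; rewrite -mulrA ler_pM2l // mulrDl.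
by rewrite lerD ?opnormP.
Qed.

Lemma opnormN T : opnorm (- T) <= opnorm T.
Proof.
apply: opnorm_le => [|f]; first exact: opnorm_ge0.
exact: le_trans (l2N _) (opnormP _ _).
Qed.

Lemma opnormM S T : opnorm (S * T) <= opnorm S * opnorm T.
Proof.
apply: opnorm_le => [|f]; first by rewrite mulr_ge0 ?opnorm_ge0.
apply: le_trans (opnormP S (T f)) _; rewrite -mulrA ler_wpM2l ?opnorm_ge0 //.
exact: opnormP.
Qed.

Implicit Types X Y : {pred bop}.

Definition commutant X : {pred bop} :=
  fun S => `[< forall T, T \in X -> S * T = T * S >].

Lemma commutant_subring X : subring_closed (commutant X).
Proof.
split=> [|S T /asboolP SX /asboolP TX|S T /asboolP SX /asboolP TX];
  apply/asboolP => U XU.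
- by rewrite mul1r mulr1.
- by rewrite mulrBl mulrBr SX ?TX.
- by rewrite -mulrA TX // mulrA SX // mulrA.
Qed.

Definition norm_closure X : {pred bop} :=
  fun T => `[< forall e : R, 0 < e -> exists2 S, S \in X & opnorm (T - S) < e >].

Lemma norm_closure_subset X : {subset X <= norm_closure X}.
Proof.
move=> T XT; apply/asboolP => e e0; exists T => //.
apply: le_lt_trans e0; rewrite subrr; apply: opnorm_le => // f.
by rewrite mul0r; case: (@l2norm0 R G).
Qed.

Lemma norm_closure_subring X : subring_closed X -> subring_closed (norm_closure X).
Proof.
case=> X1 XB XM; split=> [|S T /asboolP SX /asboolP TX|S T /asboolP SX /asboolP TX].
- exact: norm_closure_subset.
- apply/asboolP => e e0; have e4 : 0 < e / 4 by rewrite divr_gt0.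
  have [S' XS' dS] := SX _ e4; have [T' XT' dT] := TX _ e4.
  exists (S' - T'); first exact: XB.
  have -> : S - T - (S' - T') = (S - S') + (- (T - T')).
    by rewrite !opprB addrACA [RHS]addrACA [- T - S']addrC.
  apply: le_lt_trans (opnormD _ _) _; move: (opnormN (T - T')) dS dT; clear.
  by move: (opnorm _) (opnorm _) (opnorm _) => x y z; lra.
- apply/asboolP => e e0.
  have s0 := opnorm_ge0 S; have t0 := opnorm_ge0 T.
  pose K := 2 * (opnorm S + 2 * (1 + opnorm T)) + 1.
  have K1 : 0 < K by rewrite /K; nra.
  pose d := Num.min 1 (e / K).
  have d0 : 0 < d by rewrite /d lt_min ltr01 divr_gt0.
  have d1 : d <= 1 by rewrite /d ge_min lexx.
  have dK : d * K <= e by rewrite -ler_pdivlMr // /d ge_min lexx orbT.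
  have [S' XS' dS] := SX _ d0; have [T' XT' dT] := TX _ d0.
  exists (S' * T'); first exact: XM.
  have -> : S * T - S' * T' = S * (T - T') + (S - S') * T'.
    by rewrite mulrBr mulrBl addrA subrK.
  have T'n : opnorm T' <= 2 * (1 + opnorm T).
    have -> : T' = - (T - T') + T by rewrite opprB subrK.
    apply: le_trans (opnormD _ _) _; move: (opnormN (T - T')) (lt_le_trans dT d1).
    by clear; move: (opnorm _) (opnorm _) (opnorm _) => x y z; lra.
  apply: le_lt_trans (opnormD _ _) _.
  have h1 := opnormM S (T - T'); have h2 := opnormM (S - S') T'.
  have h3 : opnorm S * opnorm (T - T') <= opnorm S * d by rewrite ler_wpM2l // ltW.
  have h4 : opnorm (S - S') * opnorm T' <= d * (2 * (1 + opnorm T)).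
    by rewrite ler_pM ?opnorm_ge0 // ltW.
  move: d0 dK (le_trans h1 h3) (le_trans h2 h4); clear; rewrite /K.
  move: (opnorm (S * _)) (opnorm (_ * T')) (opnorm S) (opnorm T) d => x y s t d.
  lra.
Qed.

Lemma norm_closure_commutant X Y :
  {subset X <= commutant Y} -> {subset norm_closure X <= commutant Y}.
Proof.
move=> XY T /asboolP TX; apply/asboolP => S YS.
apply/eqP; rewrite -subr_eq0; apply/eqP/opnorm_eq0.
apply/ler_addgt0Pl => e e0; rewrite addr0.
have s0 := opnorm_ge0 S; pose K := 4 * opnorm S + 1.
have K1 : 0 < K by rewrite /K; lra.
have [T' /XY/asboolP/(_ S YS) XT' dT] := TX _ (divr_gt0 e0 K1).
have -> : T * S - S * T = (T - T') * S + - (S * (T - T')).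
  by rewrite mulrBl mulrBr XT' opprB addrA subrK.
apply: le_trans (opnormD _ _) _.
have h3 := opnormN (S * (T - T')); have h2 := opnormM S (T - T').
have h1 := opnormM (T - T') S; have h0 := opnorm_ge0 (T - T').
have : opnorm (T - T') * K <= e by rewrite -ler_pdivlMr // ltW.
move: h0 h1 h2 h3; rewrite /K; clear.
move: (opnorm (- _)) (opnorm (_ * S)) (opnorm (S * _)) (opnorm S) (opnorm (T - _)).
move=> x y z s t; lra.
Qed.

End BoundedOperators.

Section Translations.
Variables (R : realType) (G : choiceType) (e : G -> G).
Hypothesis e_inj : injective e.
Local Notation l2 := (l2 R G).

Lemma l2_comp_norm (f : l2) :
  (fun x => f (e x)) \in @square_summable R G /\ l2norm (fun x => f (e x)) <= l2norm f.
Proof.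
apply/l2norm_leP => [|F]; first exact: l2norm_ge0.
have -> : \sum_(x <- F) sqmod (f (e x)) = \sum_(x <- [fset e x | x in F]%fset) sqmod (f x).
  by rewrite big_imfset //= => x y _ _ /e_inj.
exact: l2norm_sum (l2P f).
Qed.

Definition l2_comp (f : l2) : l2 := L2 (l2_comp_norm f).1.

Lemma precomp_subproof : l2_comp \in @bounded_operator R G.
Proof.
apply/asboolP; split=> [c f g|]; first exact: val_inj.
by exists 1 => f; rewrite mul1r; exact: (l2_comp_norm f).2.
Qed.

Definition precomp : bop R G := Bop precomp_subproof.
End Translations.

Section Dirac.
Variables (R : realType) (G : choiceType).
Implicit Types (x y : G) (f : l2 R G) (F : {fset G}).

Lemma dirac_subproof x : (fun y => (y == x)%:R) \in @square_summable R G.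
Proof.
apply: (((l2norm_leP _ ler01).2 _).1) => F.
rewrite expr1n (bigID (pred1 x)) /= [X in _ + X]big1 => [|y /negPf->]; last exact: sqmod0.
rewrite addr0 big_mkcond /=; case: (boolP (x \in F)) => xF.
  rewrite (big_fsetD1 x) //= eqxx sqmod1 big_seq big1 ?addr0 // => y.
  by rewrite !inE => /andP[/negPf->].
rewrite big_seq big1 // => y yF; case: eqP => // yx; by rewrite -yx yF in xF.
Qed.

Definition dirac_l2 x : l2 R G := L2 (dirac_subproof x).

Lemma l2_sumE (I : Type) (s : seq I) (h : I -> l2 R G) y :
  (\sum_(i <- s) h i) y = \sum_(i <- s) h i y.
Proof. by elim/big_rec2: _ => // i z g _ <-. Qed.

Lemma dirac_sumE f F y :
  (\sum_(x <- F) f x *: dirac_l2 x) y = if y \in F then f y else 0.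
Proof.
have E x : (f x *: dirac_l2 x) y = f x * (y == x)%:R by [].
rewrite l2_sumE; under eq_bigr do rewrite E.
case: (boolP (y \in F)) => yF.
  rewrite (big_fsetD1 y) //= eqxx mulr1 big_seq big1 ?addr0 // => x.
  by rewrite !inE eq_sym => /andP[/negPf->]; rewrite mulr0.
rewrite big_seq big1 // => x xF; case: eqP => [yx|_].
  by rewrite yx xF in yF.
by rewrite mulr0.
Qed.

Lemma ler_sum_fset (A B : {fset G}) (s : G -> R) : (A `<=` B)%fset ->
  (forall x, 0 <= s x) -> \sum_(x <- A) s x <= \sum_(x <- B) s x.
Proof.
move=> AB s0; have -> : \sum_(x <- A) s x = \sum_(x <- B) if x \in A then s x else 0.
  rewrite -(@big_fset_incl _ _ _ _ A B) //; last by move=> x _ /negPf ->.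
  by rewrite big_seq [RHS]big_seq; apply: eq_bigr => x ->.
by apply: ler_sum => x _; case: ifP.
Qed.

Lemma l2_tail f (e : R) : 0 < e -> exists F, forall F', (F `<=` F')%fset ->
  l2norm (f - \sum_(x <- F') f x *: dirac_l2 x : l2 R G) <= e.
Proof.
move=> e0; have e2 : 0 < e ^+ 2 by rewrite exprn_gt0.
have ff : sqsum f \is a fin_num.
  by rewrite ge0_fin_numE ?sqsum_ge0 //; exact: (l2P f).
have [F FM] : exists F : {fset G}, l2norm f ^+ 2 - e ^+ 2 < \sum_(x <- F) sqmod (f x).
  apply: contrapT => /forallNP h.
  have : (sqsum f <= (l2norm f ^+ 2 - e ^+ 2)%:E)%E.
    by apply/sqsum_leP => F; rewrite leNgt; apply/negP; exact: h.
  rewrite -[X in (X <= _)%E]fineK // lee_fin /l2norm sqr_sqrtr ?fine_ge0 ?sqsum_ge0 //.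
  lra.
exists F => F' FF'.
apply: (((l2norm_leP _ (ltW e0)).2 _).2) => E.
pose s x := sqmod (f x); pose t x := if x \in F' then 0 else s x.
pose D := (F' `|` E)%fset.
have s0 x : 0 <= s x by exact: sqmod_ge0.
have t0 x : 0 <= t x by rewrite /t; case: ifP.
have -> : \sum_(x <- E) sqmod ((f - \sum_(x <- F') f x *: dirac_l2 x : l2 R G) x)
    = \sum_(x <- E) t x.
  apply: eq_bigr => y _.
  rewrite -[X in sqmod X]/(f y - (\sum_(x <- F') f x *: dirac_l2 x : l2 R G) y).
  by rewrite dirac_sumE /t /s; case: ifP => _; rewrite ?subrr ?sqmod0 ?subr0.
apply: le_trans (ler_sum_fset (fsubsetUr F' E) t0) _.
have : \sum_(x <- D) t x + \sum_(x <- F') s x = \sum_(x <- D) s x.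
  have -> : \sum_(x <- F') s x = \sum_(x <- D) if x \in F' then s x else 0.
    rewrite -(@big_fset_incl _ _ _ _ F' D) ?fsubsetUl //; last by move=> x _ /negPf ->.
    by rewrite big_seq [RHS]big_seq; apply: eq_bigr => x ->.
  by rewrite -big_split /=; apply: eq_bigr => x _; rewrite /t; case: ifP; rewrite ?add0r ?addr0.
have := ler_sum_fset FF' s0; have := l2norm_sum D (l2P f); move: FM.
rewrite -/s; lra.
Qed.

End Dirac.

Section GroupAlgebras.
Variables (R : realType) (G : groupType).
Local Notation C := R[i].
Local Notation B := (bop R G).
Local Notation l2 := (l2 R G).

Lemma lmul_inj (g : G) : injective (fun x => g^-1 * x)%g.
Proof. exact: mulgI. Qed.

Lemma rmul_inj (g : G) : injective (fun x => x * g)%g.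
Proof. exact: mulIg. Qed.

Definition lreg (g : G) : B := precomp R (@lmul_inj g).
Definition rreg (g : G) : B := precomp R (@rmul_inj g).

Lemma lreg1 : lreg 1%g = 1.
Proof.
by apply: bop_inj => f; apply/val_inj/funext => x /=; rewrite invg1 mul1g.
Qed.

Lemma lregM g h : lreg (g * h)%g = lreg g * lreg h.
Proof.
by apply: bop_inj => f; apply/val_inj/funext => x /=; rewrite invgM mulgA.
Qed.

Lemma lreg_rreg g h : lreg g * rreg h = rreg h * lreg g.
Proof.
by apply: bop_inj => f; apply/val_inj/funext => x /=; rewrite mulgA.
Qed.

(* The group ring C[G], identified with its image in B(l^2(G)) under the left *)
(* regular representation; this is faithful by group_algebra_coef.            *)
Definition group_algebra : {pred B} := fun T =>
  `[< exists s : seq (C * G), T = \sum_(cg <- s) cg.1 *: lreg cg.2 >].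

Lemma lreg_group_algebra g : lreg g \in group_algebra.
Proof. by apply/asboolP; exists [:: (1, g)]; rewrite big_seq1 scale1r. Qed.

Lemma group_algebra_subring : subring_closed group_algebra.
Proof.
split=> [|S T /asboolP[s ->] /asboolP[t ->]|S T /asboolP[s ->] /asboolP[t ->]].
- by rewrite -lreg1 lreg_group_algebra.
- apply/asboolP; exists (s ++ [seq (- cg.1, cg.2) | cg <- t]).
  rewrite big_cat big_map /= -sumrN; congr (_ + _).
  by apply: eq_bigr => cg _; rewrite scaleNr.
- apply/asboolP; exists [seq (x.1 * y.1, (x.2 * y.2)%g) | x <- s, y <- t].
  rewrite big_allpairs_dep mulr_suml; apply: eq_bigr => x _.
  rewrite mulr_sumr; apply: eq_bigr => y _.
  by rewrite bop_scaleM lregM.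
Qed.

Definition reduced_algebra : {pred B} := norm_closure group_algebra.

Definition vN_algebra : {pred B} :=
  commutant (commutant (fun T => `[< exists g, T = lreg g >])).

Lemma group_sub_reduced : {subset group_algebra <= reduced_algebra}.
Proof. exact: norm_closure_subset. Qed.

Lemma reduced_sub_vN : {subset reduced_algebra <= vN_algebra}.
Proof.
apply: norm_closure_commutant => T /asboolP[s ->]; apply/asboolP => S /asboolP SX.
rewrite mulr_suml mulr_sumr; apply: eq_bigr => cg _.
rewrite -[S in LHS]scale1r -[S in RHS]scale1r !bop_scaleM mulr1 mul1r SX //.
by apply/asboolP; exists cg.2.
Qed.

(* The coefficient of T delta_1 at 1, that is, <T delta_1, delta_1>.          *)
Definition vN_trace_fun (T : B) : C := T (dirac_l2 R 1%g) 1%g.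

Lemma vN_rreg T g : T \in vN_algebra -> T * rreg g = rreg g * T.
Proof.
move=> /asboolP; apply; apply/asboolP => S /asboolP[h ->].
by rewrite lreg_rreg.
Qed.

Lemma vN_coef T x y : T \in vN_algebra ->
  T (dirac_l2 R y) x = T (dirac_l2 R 1%g) (x * y^-1)%g.
Proof.
move=> /(vN_rreg y^-1) h.
have -> : dirac_l2 R y = rreg y^-1 (dirac_l2 R 1%g).
  by apply/val_inj/funext => z /=; rewrite -divg_eq1.
by rewrite -[T (rreg _ _)]/((T * rreg _) _) h.
Qed.

Lemma vN_prod_coef S T (e : R) : S \in vN_algebra -> 0 < e ->
  exists F : {fset G}, forall F', (F `<=` F')%fset ->
  sqmod (vN_trace_fun (S * T) - \sum_(x <- F') T (dirac_l2 R 1%g) x * S (dirac_l2 R 1%g) x^-1%g)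
    <= e.
Proof.
move=> SN e0; set f := T (dirac_l2 R 1%g).
pose K := opnorm S + 1.
have S0 := opnorm_ge0 S; have K0 : 0 < K by rewrite /K; lra.
have d0 : 0 < Num.sqrt e / K by rewrite divr_gt0 ?sqrtr_gt0.
have [F hF] := l2_tail f d0; exists F => F' /hF h.
set u := f - _ in h.
have -> : vN_trace_fun (S * T) -
    \sum_(x <- F') f x * S (dirac_l2 R 1%g) x^-1%g = S u 1%g.
  rewrite /u linearB (linear_sum S) /=.
  rewrite -[RHS]/(S f 1%g - (\sum_(i <- F') S (f i *: dirac_l2 R i)) 1%g).
  congr (_ - _); rewrite l2_sumE; apply: eq_bigr => x _.
  rewrite linearZ -[RHS]/(f x * S (dirac_l2 R x) 1%g).
  by rewrite (vN_coef 1%g x SN) mul1g.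
apply: le_trans (l2norm_coord _ (l2P _)) _.
have hS : l2norm (S u) <= Num.sqrt e.
  apply: le_trans (opnormP _ _) _; apply: (@le_trans _ _ (K * l2norm u)).
    by rewrite ler_wpM2r ?l2norm_ge0 // /K; lra.
  by rewrite mulrC -ler_pdivlMr.
apply: (@le_trans _ _ (Num.sqrt e ^+ 2)); last by rewrite sqr_sqrtr // ltW.
by rewrite lerXn2r ?nnegrE ?l2norm_ge0 ?sqrtr_ge0.
Qed.

Lemma vN_traceC S T : S \in vN_algebra -> T \in vN_algebra ->
  vN_trace_fun (S * T) = vN_trace_fun (T * S).
Proof.
move=> SN TN; apply/eqP; rewrite -subr_eq0; apply/eqP/sqmod_eq0.
apply/eqP; rewrite eq_le sqmod_ge0 andbT; apply/ler_addgt0Pl => e e0.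
rewrite addr0.
have e4 : 0 < e / 4 by rewrite divr_gt0.
have [F1 h1] := vN_prod_coef T SN e4; have [F2 h2] := vN_prod_coef S TN e4.
pose F := (F1 `|` F2)%fset; pose F' := (F `|` [fset x^-1%g | x in F])%fset.
have {}h1 := h1 F' (fsubset_trans (fsubsetUl _ _) (fsubsetUl _ _)).
have {}h2 := h2 F' (fsubset_trans (fsubsetUr _ _) (fsubsetUl _ _)).
set a := vN_trace_fun (S * T) in h1 *; set b := vN_trace_fun (T * S) in h2 *.
set c := \sum_(x <- F') _ in h1; set d := \sum_(x <- F') _ in h2.
have cd : c = d.
  have F'V : F' = [fset x^-1%g | x in F']%fset :> {fset G}.
    apply/fsetP => x; apply/idP/imfsetP => /= [xF|[y yF ->]].
      exists x^-1%g; rewrite ?invgK // /F' in_fsetU; apply/orP.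
      move: xF; rewrite in_fsetU => /orP[xF|/imfsetP[y /= yF ->]].
        by right; apply/imfsetP; exists x.
      by left; rewrite invgK.
    rewrite /F' in_fsetU; apply/orP; move: yF; rewrite in_fsetU.
    move=> /orP[yF|/imfsetP[z /= zF ->]]; last by left; rewrite invgK.
    by right; apply/imfsetP; exists y.
  rewrite /c F'V big_imfset /=; last by move=> x y _ _ /invg_inj.
  by apply: eq_bigr => x _; rewrite invgK mulrC.
have -> : a - b = (a - c) + - (b - d) by rewrite cd opprB addrA subrK.
apply: le_trans (sqmodD _ _) _.
have -> : sqmod (- (b - d)) = sqmod (b - d) by rewrite !sqmodE /=; case: (b - d) => * /=; rewrite !sqrrN.
lra.
Qed.

Lemma group_algebra_coef (s : seq (C * G)) x :
  (\sum_(cg <- s) cg.1 *: lreg cg.2) (dirac_l2 R 1%g) x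
    = \sum_(cg <- s | cg.2 == x) cg.1.
Proof.
have -> : (\sum_(cg <- s) cg.1 *: lreg cg.2) (dirac_l2 R 1%g)
   = \sum_(cg <- s) (cg.1 *: lreg cg.2) (dirac_l2 R 1%g).
  by elim/big_rec2: _ => // i y T _ <-.
rewrite l2_sumE [RHS]big_mkcond /=; apply: eq_bigr => cg _.
rewrite -[LHS]/(cg.1 * (cg.2^-1 * x == 1)%g%:R).
by rewrite mulg_eq1 (inj_eq invg_inj); case: eqP; rewrite ?mulr1 ?mulr0.
Qed.

End GroupAlgebras.

Section GroupRings.
Variables (R : realType) (G : groupType).

Record group_ring := GroupRing {
  group_ring_val :> bop R G;
  group_ringP : group_ring_val \in @group_algebra R G }.
HB.instance Definition _ := [isSub for group_ring_val].
HB.instance Definition _ := [Choice of group_ring by <:].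
HB.instance Definition _ := GRing.SubChoice_isSubPzRing.Build
  (bop R G) (@group_algebra R G) group_ring (@group_algebra_subring R G).

Record reduced_Cstar := ReducedCstar {
  reduced_Cstar_val :> bop R G;
  reduced_CstarP : reduced_Cstar_val \in @reduced_algebra R G }.
HB.instance Definition _ := [isSub for reduced_Cstar_val].
HB.instance Definition _ := [Choice of reduced_Cstar by <:].
HB.instance Definition _ := GRing.SubChoice_isSubPzRing.Build
  (bop R G) (@reduced_algebra R G) reduced_Cstar
  (norm_closure_subring (@group_algebra_subring R G)).

Record group_vN := GroupVN {
  group_vN_val :> bop R G;
  group_vNP : group_vN_val \in @vN_algebra R G }.
HB.instance Definition _ := [isSub for group_vN_val].
HB.instance Definition _ := [Choice of group_vN by <:].
HB.instance Definition _ := GRing.SubChoice_isSubPzRing.Build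
  (bop R G) (@vN_algebra R G) group_vN (@commutant_subring R G _).

Definition group_to_reduced (T : group_ring) : reduced_Cstar :=
  ReducedCstar (group_sub_reduced (group_ringP T)).

Definition reduced_to_vN (T : reduced_Cstar) : group_vN :=
  GroupVN (reduced_sub_vN (reduced_CstarP T)).

Lemma group_to_reduced_zmod : zmod_morphism group_to_reduced.
Proof. by move=> S T; apply: val_inj. Qed.
Lemma group_to_reduced_monoid : monoid_morphism group_to_reduced.
Proof. by split=> [|S T]; apply: val_inj. Qed.
HB.instance Definition _ := GRing.isZmodMorphism.Build
  group_ring reduced_Cstar group_to_reduced group_to_reduced_zmod.
HB.instance Definition _ := GRing.isMonoidMorphism.Build
  group_ring reduced_Cstar group_to_reduced group_to_reduced_monoid.

Lemma reduced_to_vN_zmod : zmod_morphism reduced_to_vN.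
Proof. by move=> S T; apply: val_inj. Qed.
Lemma reduced_to_vN_monoid : monoid_morphism reduced_to_vN.
Proof. by split=> [|S T]; apply: val_inj. Qed.
HB.instance Definition _ := GRing.isZmodMorphism.Build
  reduced_Cstar group_vN reduced_to_vN reduced_to_vN_zmod.
HB.instance Definition _ := GRing.isMonoidMorphism.Build
  reduced_Cstar group_vN reduced_to_vN reduced_to_vN_monoid.

Definition vN_trace (T : group_vN) : R[i] := vN_trace_fun T.

Lemma vN_trace_zmod : zmod_morphism vN_trace.
Proof. by []. Qed.
HB.instance Definition _ :=
  GRing.isZmodMorphism.Build group_vN R[i] vN_trace vN_trace_zmod.

Lemma vN_traceM S T : vN_trace (S * T) = vN_trace (T * S).
Proof. exact: vN_traceC (group_vNP S) (group_vNP T). Qed.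

Definition tr_vN : K0 group_vN -> R[i] := K0trace vN_trace.

HB.instance Definition _ := GRing.isZmodMorphism.Build (K0 group_vN) R[i] tr_vN
  (K0trace_is_zmod_morphism vN_traceM).

Definition kappa : K0 reduced_Cstar -> R[i] := tr_vN \o K0map reduced_to_vN.

Definition modified_trace_conjecture : Prop :=
  forall z, range kappa z -> exists2 q : rat, Lambda G q & z = ratr q.

(* The image is a subgroup, so a prime that divides the denominator of one of *)
(* its rational elements is itself the denominator of another one.            *)
Definition farkas_conjecture : Prop :=
  forall (p : nat) (q : rat), prime p -> denq q = p ->
  range (kappa \o K0map group_to_reduced) (ratr q) ->
  exists g : G, has_order g p.

End GroupRings.

(* Main.v *)
Require Import Defs.
From HB Require Import structures.
From mathcomp Require Import all_boot all_order all_algebra.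
From mathcomp Require fingroup pgroup.
From mathcomp Require Import generic_quotient finmap complex zify.
From mathcomp Require Import all_classical all_reals all_analysis.

(** Only the passage from binate groups to all groups has content, and it rests
on an embedding of an arbitrary group G in a binate group B whose elements of
prime order have orders that already occur in G.

The embedding iterates the unrestricted wreath product W(G) = G^Z x| Z.  An
element h of G, placed at the coordinate 0, is the quotient of the sequence
that is h on n >= 0 by the sequence that is h on n > 0, and the generator of Z
conjugates the second into the first; so h is a commutator of the generator
with an element that depends on h homomorphically ([at0_commutator]).  In the
direct limit B of G -> W(G) -> W(W(G)) -> ..., a finitely generated subgroup
lies in one term and finds the required data in the next one
([binate_hull_binate]).  An element of finite order of W(G) has trivial image
in the torsion-free group Z, so it is a sequence of elements of G, and if its
order is a prime p then one of its entries has order p; hence B has no new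
prime orders ([binate_hull_prime_order]).  By Cauchy's theorem the ring Lambda
of a group depends only on the primes that are orders of elements, so
Lambda_B is contained in Lambda_G ([Lambda_prime_order]).

For an injective homomorphism G -> B, the space l^2(B) is the orthogonal sum
of copies of l^2(G), one for each coset of G in B.  Letting an operator on
l^2(G) act on every summand gives a norm-decreasing ring homomorphism
([induced], [opnorm_induced]) that extends the inclusion of group rings and
preserves the trace ([induced_lreg], [induced_trace]).  It therefore maps the
reduced C^*-algebra of G to that of B, and the image of the Kaplansky trace
for G is contained in the image for B, both on the reduced C^*-algebras and on
the group rings ([kappa_range_sub], [kappa_group_range_sub]).  Both
conjectures thus pass from B to G. *)

Set Implicit Arguments.
Unset Strict Implicit.
Unset Printing Implicit Defensive.
Import Order.TTheory GRing.Theory Num.Theory.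

(** * Elements of prime order *)

Notation group_hom := UMagmaMorphism.type.

Section PrimeOrder.
Variables (G : groupType) (p : nat).
Hypothesis p_pr : prime p.

Lemma has_prime_orderP (g : G) : has_order g p <-> (g ^+ p = 1 /\ g != 1)%g.
Proof.
split=> [[_ [gp]] /(_ 1%N)|[gp g1]]; first by rewrite prime_gt1 // => /(_ isT).
split; first exact: prime_gt0.
split=> // m /andP[m0 mp]; apply: contra_neq g1 => gm.
have : coprime p m by rewrite prime_coprime // gtnNdvd.
case/(coprimeP _ (prime_gt0 p_pr)) => -[u v] /= e.
have := expgnFr g (_ : v * m <= u * p)%N; rewrite e expg1 => ->; last lia.
by rewrite mulnC expgnA gp [(v * m)%N]mulnC expgnA gm !expg1n divgg.
Qed.
End PrimeOrder.

Lemma hom_prime_order (G H : groupType) (f : group_hom G H) p (g : G) :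
  prime p -> injective f -> has_order (f g) p -> has_order g p.
Proof.
move=> p_pr f_inj /(has_prime_orderP p_pr)[fp f1].
apply/has_prime_orderP => //; split.
  by apply: f_inj; rewrite gmulfXn fp gmulf1.
by apply: contra_neq f1 => ->; exact: gmulf1.
Qed.

(** * The unrestricted wreath product with the integers *)

Section Wreath.
Variable G : groupType.

(** The pair (f, k) stands for f t^k with f a family of elements of G indexed by
the integers and t the generator that shifts families by t f t^-1 = f (_ + 1). *)
Record wreath := Wreath { lamp : int -> G; shift : int }.
HB.instance Definition _ := gen_eqMixin wreath.
HB.instance Definition _ := gen_choiceMixin wreath.

Definition wreath_mul x y :=
  Wreath (fun n => (lamp x n * lamp y (n + shift x)%R)%g) (shift x + shift y)%R.
Definition wreath_one := Wreath (fun=> 1%g) 0%R.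
Definition wreath_inv x :=
  Wreath (fun n => (lamp x (n - shift x)%R)^-1%g) (- shift x)%R.

Lemma wreath_eq x y : lamp x =1 lamp y -> shift x = shift y -> x = y.
Proof. by case: x y => [f k] [g l] /= /funext -> ->. Qed.

Lemma wreath_mulA : associative wreath_mul.
Proof. by move=> x y z; apply: wreath_eq => [n|] /=; rewrite ?mulgA addrA. Qed.
Lemma wreath_mul1g : left_id wreath_one wreath_mul.
Proof. by move=> x; apply: wreath_eq => [n|] /=; rewrite ?mul1g (addr0, add0r). Qed.
Lemma wreath_mulg1 : right_id wreath_one wreath_mul.
Proof. by move=> x; apply: wreath_eq => [n|] /=; rewrite ?mulg1 ?addr0. Qed.
Lemma wreath_mulV : left_inverse wreath_one wreath_inv wreath_mul.
Proof. by move=> x; apply: wreath_eq => [n|] /=; rewrite ?mulVg ?addNr. Qed.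
Lemma wreath_Vmul : right_inverse wreath_one wreath_inv wreath_mul.
Proof. by move=> x; apply: wreath_eq => [n|] /=; rewrite ?addrK ?mulgV ?subrr. Qed.

HB.instance Definition _ := isGroup.Build wreath
  wreath_mulA wreath_mul1g wreath_mulg1 wreath_mulV wreath_Vmul.

Definition at0 (h : G) : wreath := Wreath (fun n => if n == 0%R then h else 1%g) 0%R.
Definition at_pos (h : G) : wreath :=
  Wreath (fun n => if (0 < n)%R then h else 1%g) 0%R.
Definition unit_shift : wreath := Wreath (fun=> 1%g) 1%R.

Lemma at0_hom : monoid.monoid_morphism at0.
Proof.
split=> [|g h]; apply: wreath_eq => //= n; first by case: ifP.
by rewrite addr0; case: ifP => //; rewrite mulg1.
Qed.
HB.instance Definition _ := isUMagmaMorphism.Build G wreath at0 at0_hom.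

Lemma at0_inj : injective at0.
Proof. by move=> g h /(congr1 (fun x => lamp x 0%R)). Qed.

Lemma at_posM : {morph at_pos : g h / (g * h)%g}.
Proof.
move=> g h; apply: wreath_eq => //= n.
by rewrite addr0; case: ifP => //; rewrite mulg1.
Qed.

(** Conjugation by the shift turns the family that is h on n > 0 into the one
that is h on n >= 0, and the two differ exactly at 0. *)
Lemma at0_commutator h :
  at0 h = (unit_shift * at_pos h * unit_shift^-1 * (at_pos h)^-1)%g.
Proof.
apply: wreath_eq => [n|] //=.
rewrite !mul1g invg1 mulg1 ltzD1 !(addr0, subrr, subr0).
by case: ltgtP => _; rewrite ?mulgV ?invg1 ?mulg1.
Qed.

(** The shift is a homomorphism to a torsion-free group, so it kills an element of
finite order; the powers of such an element are computed entry by entry. *)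
Lemma wreath_prime_order p : prime p ->
  (exists x : wreath, has_order x p) -> exists g : G, has_order g p.
Proof.
move=> p_pr [x /(has_prime_orderP p_pr)[xp x1]].
have shiftX n : (shift (x ^+ n)%g = shift x *+ n)%R.
  by elim: n => [|n IH] //; rewrite expgS mulrS /= IH.
have x0 : shift x = 0%R.
  have := shiftX p; rewrite xp => /esym/eqP; rewrite mulrn_eq0 => /orP[/eqP p0|/eqP //].
  by rewrite p0 in p_pr.
have lampX n i : (lamp (x ^+ n) i = lamp x i ^+ n)%g.
  by elim: n => [|n IH] //; rewrite !expgS /= x0 addr0 IH.
have /existsNP[i /eqP xi] : ~ forall i, lamp x i = 1%g.
  by move=> h; case/eqP: x1; exact: wreath_eq.
by exists (lamp x i); apply/has_prime_orderP => //; rewrite -lampX xp.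
Qed.

End Wreath.

(** * Direct limits of sequences of groups *)

Section DirectLimit.
Local Open Scope quotient_scope.
Variables (L : nat -> groupType) (step : forall n, group_hom (L n) (L n.+1)).

(** An element of the direct limit is encoded as a sequence that eventually
follows the transition maps, up to eventual equality.  Compared with pairs of a
level and an element of that level, this makes the group operations pointwise
and avoids transporting elements to a common level. *)
Record thread := Thread {
  thread_val :> forall n, L n;
  threadP : exists N, forall n, (N <= n)%N ->
    thread_val n.+1 = step n (thread_val n) }.
HB.instance Definition _ := gen_eqMixin thread.
HB.instance Definition _ := gen_choiceMixin thread.
Implicit Types a b c : thread.

Definition tail_eq : rel thread := fun a b =>
  `[< exists N, forall n, (N <= n)%N -> a n = b n >].

Lemma tail_eq_refl : reflexive tail_eq.
Proof. by move=> a; apply/asboolP; exists 0. Qed.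
Lemma tail_eq_sym : symmetric tail_eq.
Proof. by move=> a b; apply/asboolP/asboolP => -[N e]; exists N => n /e. Qed.
Lemma tail_eq_trans : transitive tail_eq.
Proof.
move=> b a c /asboolP[M ab] /asboolP[N bc]; apply/asboolP.
by exists (maxn M N) => n; rewrite geq_max => /andP[/ab -> /bc].
Qed.
Canonical tail_equiv := EquivRel tail_eq tail_eq_refl tail_eq_sym tail_eq_trans.

Definition dirlim := {eq_quot tail_eq}.
HB.instance Definition _ : EqQuotient _ tail_eq dirlim := EqQuotient.on dirlim.
HB.instance Definition _ := Choice.on dirlim.

Lemma dirlim_eqP a b :
  \pi_dirlim a = \pi_dirlim b <-> exists N, forall n, (N <= n)%N -> a n = b n.
Proof.
by split=> [/eqP|?]; [|apply/eqP]; rewrite eqmodE /=; [move/asboolP|apply/asboolP].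
Qed.

Lemma dirlim_repr a :
  exists N, forall n, (N <= n)%N -> repr (\pi_dirlim a) n = a n.
Proof. by apply/dirlim_eqP; rewrite reprK. Qed.

Lemma thread1P : exists N, forall n, (N <= n)%N -> 1%g = step n (1%g : L n).
Proof. by exists 0 => n _; rewrite gmulf1. Qed.
Lemma threadMP a b : exists N, forall n, (N <= n)%N ->
  (a n.+1 * b n.+1)%g = step n (a n * b n)%g.
Proof.
have [M aM] := threadP a; have [N bN] := threadP b; exists (maxn M N) => n.
by rewrite geq_max => /andP[/aM -> /bN ->]; rewrite gmulfM.
Qed.
Lemma threadVP a : exists N, forall n, (N <= n)%N ->
  (a n.+1)^-1%g = step n (a n)^-1%g.
Proof. by have [M aM] := threadP a; exists M => n /aM ->; rewrite gmulfV. Qed.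

Definition thread_one := @Thread (fun=> 1%g) thread1P.
Definition thread_mul a b := Thread (threadMP a b).
Definition thread_inv a := Thread (threadVP a).

Definition dirlim_mul (x y : dirlim) : dirlim :=
  \pi_dirlim (thread_mul (repr x) (repr y)).
Definition dirlim_inv (x : dirlim) : dirlim := \pi_dirlim (thread_inv (repr x)).

Lemma dirlim_mulE a b :
  dirlim_mul (\pi_dirlim a) (\pi_dirlim b) = \pi_dirlim (thread_mul a b).
Proof.
have [M aM] := dirlim_repr a; have [N bN] := dirlim_repr b.
apply/dirlim_eqP; exists (maxn M N) => n.
by rewrite geq_max => /andP[/aM + /bN] /= => -> ->.
Qed.

Lemma dirlim_invE a : dirlim_inv (\pi_dirlim a) = \pi_dirlim (thread_inv a).
Proof.
by have [M aM] := dirlim_repr a; apply/dirlim_eqP; exists M => n /aM /= ->.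
Qed.

Lemma dirlim_mulA : associative dirlim_mul.
Proof.
elim/quotW=> a; elim/quotW=> b; elim/quotW=> c.
rewrite (dirlim_mulE b c) (dirlim_mulE a b) (dirlim_mulE a) (dirlim_mulE _ c).
by apply/dirlim_eqP; exists 0 => n _ /=; rewrite mulgA.
Qed.
Lemma dirlim_mul1g : left_id (\pi_dirlim thread_one) dirlim_mul.
Proof.
elim/quotW=> a; rewrite dirlim_mulE.
by apply/dirlim_eqP; exists 0 => n _ /=; rewrite mul1g.
Qed.
Lemma dirlim_mulg1 : right_id (\pi_dirlim thread_one) dirlim_mul.
Proof.
elim/quotW=> a; rewrite dirlim_mulE.
by apply/dirlim_eqP; exists 0 => n _ /=; rewrite mulg1.
Qed.
Lemma dirlim_mulV : left_inverse (\pi_dirlim thread_one) dirlim_inv dirlim_mul.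
Proof.
elim/quotW=> a; rewrite dirlim_invE dirlim_mulE.
by apply/dirlim_eqP; exists 0 => n _ /=; rewrite mulVg.
Qed.
Lemma dirlim_Vmul : right_inverse (\pi_dirlim thread_one) dirlim_inv dirlim_mul.
Proof.
elim/quotW=> a; rewrite dirlim_invE dirlim_mulE.
by apply/dirlim_eqP; exists 0 => n _ /=; rewrite mulgV.
Qed.

HB.instance Definition _ := isGroup.Build dirlim
  dirlim_mulA dirlim_mul1g dirlim_mulg1 dirlim_mulV dirlim_Vmul.
End DirectLimit.

(** The entries below n are filled with 1.  The induction on n replaces L by the
shifted sequence of groups, so that no test comparing m with n has to be used to
type the entry of index m. *)
Lemma thread_through (L : nat -> groupType)
    (step : forall n, group_hom (L n) (L n.+1)) n (x : L n) :
  exists2 a : thread step, a n = x &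
    forall m, (n <= m)%N -> a m.+1 = step m (a m).
Proof.
elim: n => [|n IH] in L step x *.
  pose f := fix f n : L n := if n is m.+1 then step m (f m) else x.
  have fP : exists N, forall n, (N <= n)%N -> f n.+1 = step n (f n) by exists 0.
  by exists (Thread fP).
have [a an aS] := IH _ (fun m => step m.+1) x.
pose f m : L m := if m is k.+1 then a k else 1%g.
have fS m : (n.+1 <= m)%N -> f m.+1 = step m (f m) by case: m => // m /aS.
by exists (@Thread _ step f (ex_intro _ n.+1 fS)).
Qed.

Section Inclusions.
Local Open Scope quotient_scope.
Variables (L : nat -> groupType) (step : forall n, group_hom (L n) (L n.+1)).
Hypothesis step_inj : forall n, injective (step n).

Definition into_thread n x : thread step :=
  s2val (cid2 (thread_through step (x : L n))).
Definition into n (x : L n) : dirlim step := \pi_(dirlim step) (into_thread x).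

Lemma into_thread_at n (x : L n) : into_thread x n = x.
Proof. exact: (s2valP (cid2 (thread_through step x))). Qed.

Lemma into_threadS n (x : L n) m : (n <= m)%N ->
  into_thread x m.+1 = step m (into_thread x m).
Proof. exact: (s2valP' (cid2 (thread_through step x))). Qed.

Lemma into_eq n (x : L n) (a : thread step) :
  (forall m, (n <= m)%N -> a m.+1 = step m (a m)) -> a n = x ->
  into x = \pi_(dirlim step) a.
Proof.
move=> aS an; apply/dirlim_eqP; exists n; elim=> [|m IH].
  by rewrite leqn0 => /eqP <-; rewrite into_thread_at.
rewrite leq_eqVlt => /predU1P[<-|]; first by rewrite into_thread_at.
by rewrite ltnS => nm; rewrite into_threadS // aS // IH.
Qed.

Lemma into_hom n : monoid.monoid_morphism (@into n).
Proof.
split=> [|x y]; first by apply: into_eq => // m _ /=; rewrite gmulf1.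
rewrite -[RHS]/(dirlim_mul _ _) dirlim_mulE; apply: into_eq => [m nm|] /=.
  by rewrite !into_threadS // gmulfM.
by rewrite !into_thread_at.
Qed.
HB.instance Definition _ n :=
  isUMagmaMorphism.Build (L n) (dirlim step) (@into n) (@into_hom n).

Lemma into_step n (x : L n) : into (step n x) = into x.
Proof.
apply: into_eq => [m nm|]; first by rewrite into_threadS // ltnW.
by rewrite into_threadS // into_thread_at.
Qed.

Lemma into_inj n : injective (@into n).
Proof.
move=> x y /dirlim_eqP[N xy].
have : forall k, (into_thread x (k + n) = into_thread y (k + n)) -> x = y.
  elim=> [|k IH]; first by rewrite add0n !into_thread_at.
  by rewrite addSn !into_threadS ?leq_addl // => /step_inj.
by move/(_ N); apply; apply: xy; rewrite leq_addr.
Qed.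

(** The level is found uniformly above a bound, so that finitely many elements can
be realised at one common level. *)
Lemma into_surj (z : dirlim step) : exists N, forall n, (N <= n)%N ->
  exists x : L n, z = into x.
Proof.
elim/quotW: z => a; have [N aN] := threadP a; exists N => n Nn.
by exists (a n); apply/esym/into_eq => // m nm; apply: aN; exact: leq_trans nm.
Qed.
End Inclusions.

(** * The binate hull *)

Fixpoint tower (G : groupType) n : groupType :=
  if n is m.+1 then wreath (tower G m) else G.
Definition tower_step G n : group_hom (tower G n) (tower G n.+1) :=
  @at0 (tower G n).
Definition binate_hull G := dirlim (tower_step G).

Lemma tower_step_inj G n : injective (tower_step G n).
Proof. exact: at0_inj. Qed.

Section BinateHull.
Variable G : groupType.
Let B : groupType := binate_hull G.
Let incl n : group_hom (tower G n) B := @into _ (tower_step G) n.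
Let incl_inj n : injective (incl n).
Proof. exact: into_inj (@tower_step_inj G) n. Qed.

(** The elements coming from a level form a subgroup, so it suffices to place the
generators there. *)
Lemma finitely_generated_level (H : {pred B}) : finitely_generated H ->
  exists n, forall h, h \in H -> exists x : tower G n, h = incl n x.
Proof.
case=> s [_ sgen].
have [n sn] : exists n, forall h, h \in s -> exists x : tower G n, h = incl n x.
  elim: s {sgen} => [|h s [n sn]]; first by exists 0%N.
  have [m hm] := into_surj h; exists (maxn m n) => k; rewrite inE => /predU1P[->|].
    by apply: hm; exact: leq_maxl.
  (* An element of level n is moved up to the common level along its thread. *)
  case/sn=> x ->; have [a an aS] := thread_through (tower_step G) x.
  exists (a (maxn m n)); rewrite /incl /= (into_eq aS an).
  apply/esym/into_eq => // l /(leq_trans (leq_maxr m n)); exact: aS.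
exists n => h hH; apply/asboolP.
apply: (sgen (fun h => `[< exists x : tower G n, h = incl n x >])) hH => [|k /sn ks].
  split=> [|_ _ /asboolP[x ->] /asboolP[y ->]]; apply/asboolP.
    by exists 1%g; rewrite gmulf1.
  by exists (x / y)%g; rewrite gmulfF.
exact/asboolP.
Qed.

(** The subgroup H is pulled back to a level n of the tower; the homomorphism and
the element required by the definition exist at the level n + 1. *)
Lemma binate_hull_binate : binate B.
Proof.
split=> [|H Hgrp /finitely_generated_level[n Hn]].
  exists (incl 1 (unit_shift G)); apply/negP => /eqP.
  by rewrite -(@gmulf1 _ _ (incl 1)) => /incl_inj /(congr1 (@shift _)).
(* A preimage at level n, with an arbitrary value off H. *)
pose lev h := xget 1%g (fun x : tower G n => incl n x = h).
have levE h : h \in H -> incl n (lev h) = h.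
  by case/Hn => x hx; apply: (xgetPex _ (P := fun x => incl n x = h)); exists x.
exists (fun h => incl n.+1 (at_pos (lev h))), (incl n.+1 (unit_shift _)).
split=> [g h gH hH|h hH]; last first.
  rewrite -[h in LHS]levE // -[LHS](into_step (tower_step G)) /=.
  by rewrite at0_commutator !(gmulfM, gmulfV).
have -> : lev (g * h)%g = (lev g * lev h)%g.
  by apply: incl_inj; rewrite gmulfM !levE // (group_closedM Hgrp).
by rewrite at_posM gmulfM.
Qed.

Lemma binate_hull_prime_order p : prime p ->
  (exists b : B, has_order b p) -> exists g : G, has_order g p.
Proof.
move=> p_pr [b]; have [n /(_ n (leqnn n)) [x ->]] := into_surj b.
move=> /(hom_prime_order p_pr (@incl_inj n)) {b} xp.
have {xp} : exists x : tower G n, has_order x p by exists x.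
elim: n {x} => [//|n IH] /(wreath_prime_order p_pr); exact: IH.
Qed.
End BinateHull.

(** * The ring Lambda is determined by the prime orders *)

Module FsetCauchy.
Import fingroup pgroup.
Section FsetGroup.
Variables (B : groupType) (F : {fset B}).
Hypothesis Fgrp : group_closed [in F].

(** The closure hypothesis is recorded in the type so that the group structure can
be inferred from it. *)
Definition fset_group := let _ := Fgrp in F : Type.
HB.instance Definition _ := SubType.on fset_group.
HB.instance Definition _ := Finite.on fset_group.
HB.instance Definition _ := SubChoice_isSubGroup.Build B _ fset_group Fgrp.

End FsetGroup.

Lemma fset_Cauchy (B : groupType) (F : {fset B}) p :
  group_closed [in F] -> prime p -> (p %| #|` F|)%N ->
  exists2 g : B, (g ^+ p = 1)%g & g != 1%g.
Proof.
move=> Fgrp p_pr; have -> : #|` F| = #|[set: (fset_group Fgrp : finGroupType)]%G|.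
  by rewrite cardsT cardfE.
move=> /(Cauchy p_pr)[x _ ox]; exists (val x).
  by rewrite -gmulfXn -ox expg_order gmulf1.
apply/negP => /eqP x1.
have : x = 1%g by apply: val_inj; rewrite x1 gmulf1.
by move=> e; rewrite e order1 in ox; rewrite -ox in p_pr.
Qed.
End FsetCauchy.

Lemma cyclic_fset (G : groupType) (g : G) p : (0 < p)%N -> has_order g p ->
  exists2 K : {fset G}, group_closed [in K] & #|` K| = p.
Proof.
move=> p0 [_ [gp gN1]]; exists [fset x in [seq (g ^+ i)%g | i <- iota 0 p]]%fset.
  split=> [|x y]; rewrite !inE /=.
    by apply/mapP; exists 0%N; rewrite ?mem_iota.
  move=> /mapP[i + ->] /mapP[j + ->] {x y}; rewrite !mem_iota !add0n /= => ip jp.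
  (* The exponent p - j stands for - j modulo p. *)
  apply/mapP; exists ((i + (p - j)) %% p)%N; first by rewrite mem_iota ltn_mod.
  have gmod n : (g ^+ n = g ^+ (n %% p))%g.
    by rewrite [in LHS](divn_eq n p) expgnDr mulnC expgnA gp expg1n mul1g.
  by rewrite -gmod expgnDr expgnFr ?gp ?mul1g // ltnW.
rewrite card_fseq undup_id ?size_map ?size_iota // map_inj_in_uniq ?iota_uniq //.
move=> i j; rewrite !mem_iota !add0n /= => ip jp.
wlog ij : i j ip jp / (i <= j)%N => [h e|e].
  by case/orP: (leq_total i j) => /h; [apply|move=> h'; apply/esym/h'].
apply/eqP; rewrite eqn_leq ij leqNgt; apply/negP => ij'.
have /negP[] := gN1 (j - i)%N (ltac:(lia)).
by rewrite expgnFr // e mulgV.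
Qed.

(** By Cauchy's theorem a prime p that divides the order of a finite subgroup of B
is the order of an element of B, hence of a cyclic subgroup of G, so 1/p lies in
Lambda_G; and 1/|F| is a product of such fractions. *)
Lemma Lambda_prime_order (B G : groupType) :
  (forall p, prime p -> (exists b : B, has_order b p) -> exists g : G, has_order g p) ->
  (Lambda B `<=` Lambda G)%classic.
Proof.
move=> BG q qB S Ssub SG; apply: qB => // F Fgrp; case: (Ssub) => S1 _ SM.
have F0 : (0 < #|` F|)%N by rewrite cardfs_gt0; apply/fset0Pn; exists 1%g; case: Fgrp.
have pS p : prime p -> (p %| #|` F|)%N -> (p%:R^-1 : rat)%R \in S.
  move=> p_pr /(FsetCauchy.fset_Cauchy Fgrp p_pr)[b bp b1].
  have [g /(cyclic_fset (prime_gt0 p_pr))[K Kgrp Kp]] : exists g : G, has_order g p.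
    by apply: BG => //; exists b; apply/has_prime_orderP.
  by rewrite -Kp; exact: SG.
suff nS n : (0 < n)%N -> (n %| #|` F|)%N -> (n%:R^-1 : rat)%R \in S by exact: nS.
elim/ltn_ind: n => n IH n0 nF.
have [n1|n1] := leqP n 1; first by rewrite (_ : n = 1%N) ?invr1 //; lia.
have p_pr := pdiv_prime n1; have pn := pdiv_dvd n.
rewrite -(divnK pn) natrM invfM; apply: SM.
  apply: IH; first by rewrite ltn_Pdiv ?prime_gt1.
    by rewrite divn_gt0 ?prime_gt0 // dvdn_leq.
  exact: dvdn_trans (dvdn_div pn) nF.
by apply: pS => //; exact: dvdn_trans pn nF.
Qed.

(** * Operators induced from a subgroup *)

Local Open Scope ring_scope.
Local Open Scope complex_scope.
Local Open Scope classical_set_scope.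

Section Induction.
Variables (R : realType) (G B : groupType) (j : group_hom G B).
Hypothesis j_inj : injective j.
Local Notation C := R[i].

(** A choice of representatives identifies B with the product of G and the set of
right cosets of the image of G; [coset_coord] and [coset_rep] are the two
coordinates. *)
Definition same_coset (b c : B) : Prop := exists g, c = (j g * b)%g.
Definition coset_rep (b : B) : B := xget 1%g (same_coset b).
Definition coset_coord (b : B) : G := xget 1%g [set g | b = (j g * coset_rep b)%g].

Lemma coset_decomp b : b = (j (coset_coord b) * coset_rep b)%g.
Proof.
have [g rg] : same_coset b (coset_rep b).
  by apply: (xgetPex _ (P := same_coset b)); exists b, 1%g; rewrite gmulf1 mul1g.
apply: (xgetPex _ (P := fun g => b = (j g * coset_rep b)%g)).
by exists g^-1%g; rewrite rg gmulfV mulKg.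
Qed.

Lemma coset_repJ g b : coset_rep (j g * b)%g = coset_rep b.
Proof.
have cosetJ : same_coset (j g * b)%g = same_coset b.
  apply/funext => c; apply/propext; split=> -[h ->].
    by exists (h * g)%g; rewrite gmulfM mulgA.
  by exists (h / g)%g; rewrite gmulfF mulgA mulgVK.
by rewrite /coset_rep cosetJ.
Qed.

Lemma coset_coordJ g b : coset_coord (j g * b)%g = (g * coset_coord b)%g.
Proof.
apply: j_inj; apply: (@mulIg _ (coset_rep b)).
by rewrite -{1}(coset_repJ g) -coset_decomp gmulfM -mulgA -coset_decomp.
Qed.

Lemma coset_rep_id b : coset_rep (coset_rep b) = coset_rep b.
Proof. by rewrite [in RHS](coset_decomp b) coset_repJ. Qed.

Lemma coset_coord_coset_rep b : coset_coord (coset_rep b) = 1%g.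
Proof.
apply: j_inj; apply: (@mulIg _ (coset_rep b)).
by rewrite -[X in (_ * X)%g = _]coset_rep_id -coset_decomp gmulf1 mul1g.
Qed.

Definition coset_reps := range coset_rep.

(** This is the decomposition of l^2(B) as a sum of copies of l^2(G) indexed by
the cosets, at the level of square norms. *)
Lemma sqsum_cosets (f : B -> C) :
  sqsum f = \esum_(r in coset_reps) sqsum (fun x => f (j x * r)%g).
Proof.
rewrite /sqsum esum_esum; last by move=> *; rewrite lee_fin sqmod_ge0.
apply: (@reindex_esum _ _ _ _ _ (fun rx : B * G => (j rx.2 * rx.1)%g)).
split=> [//|[r x] [s y] /=|b _] /=.
  rewrite !inE => -[/= [b _ <-] _] [/= [c _ <-] _] e.
  have := congr1 coset_rep e; rewrite !coset_repJ !coset_rep_id => bc.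
  by congr (_, _) => //; apply: j_inj; apply: (@mulIg _ (coset_rep c)); rewrite -{1}bc.
exists (coset_rep b, coset_coord b); last by rewrite /= -coset_decomp.
by split => //; exists b.
Qed.

Lemma l2_slice_subproof (f : l2 R B) (r : B) :
  (fun x => f (j x * r)%g) \in @square_summable R G.
Proof.
apply: (((l2norm_leP _ (l2norm_ge0 f)).2 _).1) => F.
have -> : \sum_(x <- F) sqmod (f (j x * r)%g)
    = \sum_(b <- [fset (j x * r)%g | x in F]%fset) sqmod (f b).
  by rewrite big_imfset //= => x y _ _ /mulIg /j_inj.
exact: l2norm_sum (l2P f).
Qed.

Definition l2_slice (r : B) (f : l2 R B) : l2 R G := L2 (l2_slice_subproof f r).

Lemma l2_sliceP (r : B) : linear (l2_slice r).
Proof. by move=> c f g; exact: val_inj. Qed.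

Lemma sqsum_l2norm (T : choiceType) (f : l2 R T) : sqsum f = (l2norm f ^+ 2)%:E.
Proof.
have ff : sqsum f \is a fin_num by rewrite ge0_fin_numE ?sqsum_ge0 //; exact: (l2P f).
by rewrite /l2norm sqr_sqrtr ?fine_ge0 ?sqsum_ge0 // fineK.
Qed.

(** When l^2(B) is identified with the tensor product of l^2(G) and l^2 of the set
of cosets, this is T tensored with the identity. *)
Definition induced_fun (T : bop R G) (f : l2 R B) (b : B) : C :=
  T (l2_slice (coset_rep b) f) (coset_coord b).

Lemma induced_slice T f (r : B) : coset_reps r ->
  (fun x => induced_fun T f (j x * r)%g) = T (l2_slice r f).
Proof.
move=> [b _ <-]; apply/funext => x; rewrite /induced_fun.
by rewrite coset_repJ coset_rep_id coset_coordJ coset_coord_coset_rep mulg1.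
Qed.

(** The bound for T applies to every slice, and the square norms of the slices add
up to that of f. *)
Lemma induced_sqsum T f : (sqsum (induced_fun T f) <= ((opnorm T * l2norm f) ^+ 2)%:E)%E.
Proof.
rewrite sqsum_cosets; apply: ge_ereal_sup => _ [X [finX XR] <-].
apply: (@le_trans _ _ (\sum_(r \in X) (opnorm T ^+ 2)%:E * sqsum (l2_slice r f))%E).
  apply: lee_fsum => // r /XR Rr; rewrite induced_slice // !sqsum_l2norm.
  rewrite -EFinM -exprMn lee_fin lerXn2r ?nnegrE ?mulr_ge0 ?opnorm_ge0 ?l2norm_ge0 //.
  exact: opnormP.
rewrite -ge0_mule_fsumr; last by move=> r; exact: sqsum_ge0.
rewrite exprMn [leRHS]EFinM -(sqsum_l2norm f).
rewrite lee_wpmul2l ?lee_fin ?sqr_ge0 // (sqsum_cosets f).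
by apply: esum_ge; exists X.
Qed.

Lemma induced_l2 T f : induced_fun T f \in @square_summable R B /\
  l2norm (induced_fun T f) <= opnorm T * l2norm f.
Proof.
apply/l2norm_leP; first by rewrite mulr_ge0 ?opnorm_ge0 ?l2norm_ge0.
exact/sqsum_leP/induced_sqsum.
Qed.

Definition induced_op T (f : l2 R B) : l2 R B := L2 (induced_l2 T f).1.

Lemma induced_op_bounded T : induced_op T \in @bounded_operator R B.
Proof.
apply/asboolP; split=> [c f g|].
  by apply/val_inj/funext => b; rewrite /= /induced_fun l2_sliceP linearP.
by exists (opnorm T) => f; exact: (induced_l2 T f).2.
Qed.

Definition induced T : bop R B := Bop (induced_op_bounded T).

Lemma opnorm_induced T : opnorm (induced T) <= opnorm T.
Proof. by apply: opnorm_le => [|f]; [exact: opnorm_ge0|exact: (induced_l2 T f).2]. Qed.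

Lemma induced_slice_op T f b :
  l2_slice (coset_rep b) (induced T f) = T (l2_slice (coset_rep b) f).
Proof. by apply: val_inj; apply: induced_slice; exists b. Qed.

Lemma inducedB S T : induced (S - T) = induced S - induced T.
Proof. by apply: bop_inj => f; exact: val_inj. Qed.

Lemma inducedD S T : induced (S + T) = induced S + induced T.
Proof. by apply: bop_inj => f; exact: val_inj. Qed.

Lemma inducedZ (c : C) T : induced (c *: T) = c *: induced T.
Proof. by apply: bop_inj => f; exact: val_inj. Qed.

Lemma inducedM S T : induced (S * T) = induced S * induced T.
Proof.
apply: bop_inj => f; apply/val_inj/funext => b.
by rewrite /= /induced_fun induced_slice_op.
Qed.

Lemma induced_lreg g : induced (lreg R g) = lreg R (j g).
Proof.
apply: bop_inj => f; apply/val_inj/funext => b.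
by rewrite /= /induced_fun /= gmulfM gmulfV -mulgA -coset_decomp.
Qed.

Lemma induced1 : induced 1 = 1.
Proof. by rewrite -(Defs.lreg1 R G) induced_lreg gmulf1 Defs.lreg1. Qed.

Lemma induced_group_algebra T :
  T \in @group_algebra R G -> induced T \in @group_algebra R B.
Proof.
move=> /asboolP[s ->]; apply/asboolP.
exists [seq (cg.1, j cg.2) | cg <- s]; rewrite big_map /=.
elim: s => [|cg s IH]; first by rewrite !big_nil -[0]subr0 inducedB subrr.
by rewrite !big_cons inducedD inducedZ induced_lreg IH.
Qed.

(** Induction does not increase norms, so it carries approximations of T by elements
of the group ring of G to approximations of the induced operator. *)
Lemma induced_reduced T :
  T \in @reduced_algebra R G -> induced T \in @reduced_algebra R B.
Proof.
move=> /asboolP TG; apply/asboolP => e /TG[S SG TS]; exists (induced S).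
  exact: induced_group_algebra.
by rewrite -inducedB; exact: le_lt_trans (opnorm_induced _) TS.
Qed.

(** The slice of delta_1 over the coset of 1 is delta_y, with y the coordinate of 1,
so the trace of the induced operator is the coefficient of T delta_y at y.  For T
in the von Neumann algebra all diagonal coefficients agree. *)
Lemma induced_trace T : T \in @vN_algebra R G ->
  vN_trace_fun (induced T) = vN_trace_fun T.
Proof.
move=> TN; rewrite /vN_trace_fun /= /induced_fun.
pose y := coset_coord 1%g.
have -> : l2_slice (coset_rep 1%g) (dirac_l2 R 1%g) = dirac_l2 R y.
  apply/val_inj/funext => x /=; congr (_%:R : C).
  have e : coset_rep 1%g = (j y)^-1%g by apply/esym/mulg1_eq/esym/coset_decomp.
  by rewrite e divg_eq1 (inj_eq j_inj).
by rewrite vN_coef // mulgV.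
Qed.

End Induction.

(** * The Kaplansky trace of induced classes *)

Section K0Computations.
Local Open Scope quotient_scope.

Definition K0_in (A : pzRingType) (p : idempotent_mx A) : K0 A :=
  groth_in (\pi_(proj_class A) p).

Lemma idem_eq (A : pzRingType) n (a b : 'M[A]_n) (aP : a *m a = a) (bP : b *m b = b) :
  a = b -> IdempotentMx aP = IdempotentMx bP.
Proof. by move=> e; case: _ / e bP => bP; rewrite (Prop_irrelevance aP bP). Qed.

Lemma K0_difference (A : pzRingType) (u : K0 A) :
  exists p q : idempotent_mx A, u = K0_in p - K0_in q.
Proof.
elim/quotW: u => -[x y]; elim/quotW: x => p; elim/quotW: y => q.
by exists p, q; rewrite groth_piE.
Qed.

Lemma K0map_in (A A' : pzRingType) (f : {rmorphism A -> A'}) p :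
  K0map f (K0_in p) = K0_in (map_idem f p).
Proof.
by rewrite /K0map /K0_in groth_lift_in; exact: (congr1 (@groth_in _) (proj_map_pi f p)).
Qed.

Lemma K0mapB (A A' : pzRingType) (f : {rmorphism A -> A'}) :
  {morph K0map f : u v / u - v}.
Proof. exact: (raddfB (K0map f)). Qed.

Lemma K0trace_in (A : pzRingType) (Z : zmodType) (tau : {additive A -> Z}) :
  (forall a b, tau (a * b) = tau (b * a)) ->
  forall p, K0trace tau (K0_in p) = tau (\tr (idem_mx p)).
Proof.
move=> tauC p; have h := proj_trace_is_nmod_morphism tauC.
pose f := GRing.isNmodMorphism.Build _ _ (proj_trace tau) h.
pose F : {additive proj_class A -> Z} := HB.pack (proj_trace tau) f.
by rewrite /K0trace /K0_in (groth_lift_in F) /= proj_trace_pi.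
Qed.
End K0Computations.

Section Kappa.
Variables (R : realType).
Implicit Types G B : groupType.

Lemma kappaB G : {morph @kappa R G : u v / u - v}.
Proof. by move=> u v; rewrite /kappa /= K0mapB (raddfB (@tr_vN R G)). Qed.

Lemma kappa_in G (p : idempotent_mx (reduced_Cstar R G)) :
  kappa (K0_in p) = vN_trace_fun (\tr (idem_mx p) : reduced_Cstar R G).
Proof.
rewrite /kappa /= K0map_in /tr_vN K0trace_in; last exact: vN_traceM.
by rewrite /= trace_map_mx.
Qed.

Variables (G B : groupType) (j : group_hom G B).
Hypothesis j_inj : injective j.

Definition induced_Cstar (T : reduced_Cstar R G) : reduced_Cstar R B :=
  ReducedCstar (induced_reduced j_inj (reduced_CstarP T)).
Lemma induced_Cstar_zmod : zmod_morphism induced_Cstar.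
Proof. by move=> S T; apply: val_inj; exact: inducedB. Qed.
Lemma induced_Cstar_monoid : monoid_morphism induced_Cstar.
Proof. by split=> [|S T]; apply: val_inj; [exact: induced1|exact: inducedM]. Qed.
HB.instance Definition _ := GRing.isZmodMorphism.Build
  (reduced_Cstar R G) (reduced_Cstar R B) induced_Cstar induced_Cstar_zmod.
HB.instance Definition _ := GRing.isMonoidMorphism.Build
  (reduced_Cstar R G) (reduced_Cstar R B) induced_Cstar induced_Cstar_monoid.

Definition induced_ring (T : group_ring R G) : group_ring R B :=
  GroupRing (induced_group_algebra j_inj (group_ringP T)).
Lemma induced_ring_zmod : zmod_morphism induced_ring.
Proof. by move=> S T; apply: val_inj; exact: inducedB. Qed.
Lemma induced_ring_monoid : monoid_morphism induced_ring.
Proof. by split=> [|S T]; apply: val_inj; [exact: induced1|exact: inducedM]. Qed.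
HB.instance Definition _ := GRing.isZmodMorphism.Build
  (group_ring R G) (group_ring R B) induced_ring induced_ring_zmod.
HB.instance Definition _ := GRing.isMonoidMorphism.Build
  (group_ring R G) (group_ring R B) induced_ring induced_ring_monoid.

(** K_0 is generated by classes of idempotent matrices, and on these both sides are
traces of one element of the reduced C^*-algebra and of its induced operator. *)
Lemma kappa_induced u : kappa (K0map induced_Cstar u) = kappa u.
Proof.
suff kappaE p : kappa (K0map induced_Cstar (K0_in p)) = kappa (K0_in p).
  have [p [q ->]] := K0_difference u.
  by rewrite K0mapB [LHS]kappaB [RHS]kappaB !kappaE.
rewrite K0map_in !kappa_in trace_map_mx.
exact/induced_trace/reduced_sub_vN/reduced_CstarP.
Qed.

(** The square formed by the inclusions of the group rings in the reduced
C^*-algebras and by the induced maps commutes. *)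
Lemma K0map_induced u :
  K0map (group_to_reduced (G := B)) (K0map induced_ring u)
  = K0map induced_Cstar (K0map (group_to_reduced (G := G)) u).
Proof.
suff inE p : K0map (group_to_reduced (G := B)) (K0map induced_ring (K0_in p))
    = K0map induced_Cstar (K0map (group_to_reduced (G := G)) (K0_in p)).
  have [p [q ->]] := K0_difference u.
  by rewrite [K0map induced_ring _]K0mapB [K0map (group_to_reduced (G := G)) _]K0mapB
    [LHS]K0mapB [RHS]K0mapB !inE.
rewrite !K0map_in; congr K0_in; apply: idem_eq; apply/matrixP => k l.
by rewrite !mxE; exact: val_inj.
Qed.

Lemma kappa_range_sub : range (@kappa R G) `<=` range (@kappa R B).
Proof. by move=> _ [u _ <-]; exists (K0map induced_Cstar u); rewrite // kappa_induced. Qed.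

Lemma kappa_group_range_sub :
  range (@kappa R G \o K0map (@group_to_reduced R G)) `<=`
  range (@kappa R B \o K0map (@group_to_reduced R B)).
Proof.
move=> _ [u _ <-]; exists (K0map induced_ring u) => //=.
by rewrite K0map_induced kappa_induced.
Qed.

End Kappa.

Theorem corollary4p6 (R : realType) :
  ((forall G : groupType, modified_trace_conjecture R G) <->
   (forall G : groupType, binate G -> modified_trace_conjecture R G)) /\
  ((forall G : groupType, farkas_conjecture R G) <->
   (forall G : groupType, binate G -> farkas_conjecture R G)).
Proof.
have inj (G : groupType) : injective (@into _ (tower_step G) 0).
  exact: (into_inj (@tower_step_inj G)).
split; split=> [h G _|h G]; try exact: h.
  move=> z /(kappa_range_sub (@inj G)) /(h _ (binate_hull_binate G))[q qB ->].
  exists q => //; apply: Lambda_prime_order qB => p p_pr.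
  exact: binate_hull_prime_order.
move=> p q p_pr qp /(kappa_group_range_sub (@inj G)).
move=> /(h _ (binate_hull_binate G) p q p_pr qp) ox.
exact: binate_hull_prime_order p_pr ox.
Qed.
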